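(* Let $P,Q$ be non-constant rational functions with complex coefficients, $\deg P=n$, $\deg Q=m$. Then any of the conditions below implies the irreducibility of the curve $h_{P,Q}(x,y)=0$: 1) $\mathcal C(P)\cap\mathcal C(Q)$ contains at most one element; 2) $\gcd(n,m)=1$; 3) $P$ is a polynomial and $Q$ is a rational function with no multiple poles in $\mathbb{CP}^1$.
   Context: A rational function $F$ is regarded as a holomorphic map $\mathbb{CP}^1\to\mathbb{CP}^1$ of degree $\deg F$. A point $s\in\mathbb{CP}^1$ is called a critical value of $F$ if $F^{-1}\{s\}$ contains fewer than $\deg F$ points; $\mathcal C(F)$ is the set of all critical values of $F$. Write $P=P_1/P_2$, $Q=Q_1/Q_2$, where $P_1,P_2$ and $Q_1,Q_2$ are pairs of polynomials without common roots. The curve $h_{P,Q}(x,y)=0$ is the affine algebraic curve $$h_{P,Q}(x,y):\ P_1(x)Q_2(y)-P_2(x)Q_1(y)=0,$$ and it is called irreducible if the polynomial on the left-hand side is irreducible in $\mathbb C[x,y]$. Poles are considered on $\mathbb{CP}^1$, i.e. $Q$ has no multiple poles if every point of $Q^{-1}\{\infty\}\subset\mathbb{CP}^1$ (including possibly the point $\infty$) has local multiplicity 1; equivalently, $\infty\notin\mathcal C(Q)$. *)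

(* Defs.v *)
From HB Require Import structures.
From mathcomp Require Import all_boot all_order all_algebra.
From mathcomp Require Import complex.
From mathcomp Require Import boolp classical_sets functions cardinality reals.

Set Implicit Arguments.
Unset Strict Implicit.
Unset Printing Implicit Defensive.

Import Order.TTheory GRing.Theory Num.Theory.
Local Open Scope ring_scope.
Local Open Scope classical_set_scope.

(* The projective line K u {oo}; None is the point oo. *)
Definition CP1 (K : closedFieldType) : Type := option K.

(* The point of CP1 with homogeneous coordinates [a : b], (a, b) != (0, 0). *)
Definition CP1_of_coords (K : closedFieldType) (a b : K) : CP1 K :=
  if b == 0 then None else Some (a / b).

Record ratfun (K : closedFieldType) := Ratfun {
  rnum : {poly K};
  rden : {poly K};
  rden_neq0 : rden != 0;
  no_common_root : forall z : K, ~~ (root rnum z && root rden z)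
}.

Definition ratfun_frac (K : closedFieldType) (F : ratfun K) :
    {fraction {poly K}} :=
  tofrac (rnum F) / tofrac (rden F).

Definition constant_ratfun (K : closedFieldType) (F : ratfun K) : Prop :=
  exists c : K, ratfun_frac F = tofrac c%:P.

Definition is_polynomial (K : closedFieldType) (F : ratfun K) : Prop :=
  exists p : {poly K}, ratfun_frac F = tofrac p.

Definition deg (K : closedFieldType) (F : ratfun K) : nat :=
  maxn (size (rnum F)).-1 (size (rden F)).-1.

(* At oo, F takes the value [a : b] where a and b are the coefficients of
   degree deg F of the numerator and of the denominator. *)
Definition ratfun_map (K : closedFieldType) (F : ratfun K) (z : CP1 K) :
    CP1 K :=
  if z is Some x then CP1_of_coords (rnum F).[x] (rden F).[x]
  else CP1_of_coords (rnum F)`_(deg F) (rden F)`_(deg F).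

Definition fiber (K : closedFieldType) (F : ratfun K) (s : CP1 K) :
    set (CP1 K) :=
  ratfun_map F @^-1` [set s].

Definition critical_values (K : closedFieldType) (F : ratfun K) :
    set (CP1 K) :=
  [set s | exists2 k : nat, (k < deg F)%N & (fiber F s #= `I_k)%card].

(* The finite points of the fiber over s are the roots of this polynomial. *)
Definition fiber_poly (K : closedFieldType) (F : ratfun K) (s : CP1 K) :
    {poly K} :=
  if s is Some c then rnum F - c *: rden F else rden F.

(* Local multiplicity (local degree) of a non-constant F at z.  With p the
   polynomial of the fiber through z, at z = oo it is the order of vanishing
   at w = 0 of w ^ deg F * p (1 / w). *)
Definition local_mult (K : closedFieldType) (F : ratfun K) (z : CP1 K) : nat :=
  let p := fiber_poly F (ratfun_map F z) in
  if z is Some x then mup x p else (deg F - (size p).-1)%N.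

Definition no_multiple_poles (K : closedFieldType) (F : ratfun K) : Prop :=
  forall z : CP1 K, fiber F None z -> local_mult F z = 1%N.

(* K[x, y] is {poly {poly K}} with x the outer variable 'X and y the inner
   variable 'X%:P, so that p^:P is p(x) and p%:P is p(y). *)
Definition hPQ (K : closedFieldType) (P Q : ratfun K) : {poly {poly K}} :=
  (rnum P)^:P * (rden Q)%:P - (rden P)^:P * (rnum Q)%:P.

(* On {poly {poly K}}, irreducible_poly from polydiv refers to
   pseudo-divisibility and so ignores factors in the inner variable alone;
   this is irreducibility in the ring itself. *)
Definition irreducible_elt (A : idomainType) (p : A) : Prop :=
  [/\ p != 0, p \isn't a GRing.unit &
      forall q r : A, p = q * r ->
        q \is a GRing.unit \/ r \is a GRing.unit].

(* Main.v *)
(* Write F = K(x) and t = P(x).  When the critical values meet in at most one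
   point, a Moebius map of the target puts that point at infinity, and changes
   of coordinates make P and Q have a pole at infinity.  A factor of the curve
   is then, up to a scalar, a monic factor A of Q1(Y) - t Q2(Y) in F[Y] whose
   coefficients are regular away from the poles of P.  Let D be the derivation
   of F with D t = 1.  Over a finite value of t not critical for Q the derivative
   D A is expressed through A itself, and over one not critical for P the
   derivation preserves regularity; hence all iterated derivatives of the
   coefficients of A are regular away from the poles of P.  As D lowers the
   orders of the poles, these derivatives eventually vanish, so the coefficients
   lie in K[t].  But Q1(Y) - t Q2(Y) is irreducible over K(t).  This algebraic
   argument replaces monodromy: the affine line is simply connected.

   For coprime degrees, a factor of bidegree (a, b) satisfies m a = n b by
   counting its zeros on a product of two generic fibres.  For a polynomial P
   and a simple pole of Q, Eisenstein's criterion applies at that pole. *)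
Require Import Defs.
From HB Require Import structures.
From mathcomp Require Import all_boot all_order all_algebra all_field.
From mathcomp Require Import complex.
From mathcomp Require Import boolp classical_sets functions cardinality reals.
From mathcomp Require Import ring zify.

Set Implicit Arguments.
Unset Strict Implicit.
Unset Printing Implicit Defensive.

Import Order.TTheory GRing.Theory Num.Theory.
Local Open Scope ring_scope.
Local Open Scope classical_set_scope.

(** * Derivations and subrings *)

Record subring (F : nzRingType) (S : F -> Prop) : Prop := Subring {
  subring1 : S 1;
  subringB : forall f g, S f -> S g -> S (f - g);
  subringM : forall f g, S f -> S g -> S (f * g) }.

Section Subring.
Variables (F : nzRingType) (S : F -> Prop).
Hypothesis subS : subring S.

Lemma subring0 : S 0.
Proof. by rewrite -(subrr 1); apply: subringB; rewrite ?subring1 //; case: subS. Qed.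

Lemma subringN f : S f -> S (- f).
Proof. by move=> Sf; rewrite -sub0r; apply: subringB => //; exact: subring0. Qed.

Lemma subringD f g : S f -> S g -> S (f + g).
Proof. by move=> Sf /subringN Sg; rewrite -[g]opprK; apply: subringB. Qed.

Lemma subring_sum I (r : seq I) (P : pred I) (f : I -> F) :
  (forall i, P i -> S (f i)) -> S (\sum_(i <- r | P i) f i).
Proof. by move=> Sf; apply: big_ind => //; [exact: subring0 | exact: subringD]. Qed.

Lemma subringX f k : S f -> S (f ^+ k).
Proof.
move=> Sf; elim: k => [|k IHk]; first by rewrite expr0; case: subS.
by rewrite exprS; apply: subringM.
Qed.

Lemma subringMn f k : S f -> S (f *+ k).
Proof.
move=> Sf; elim: k => [|k IHk]; first by rewrite mulr0n; exact: subring0.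
by rewrite mulrS; apply: subringD.
Qed.

Definition coefs_in (p : {poly F}) := forall i, S p`_i.

Lemma coefs_inB p q : coefs_in p -> coefs_in q -> coefs_in (p - q).
Proof. by move=> Sp Sq i; rewrite coefB; apply: subringB. Qed.

Lemma coefs_inM p q : coefs_in p -> coefs_in q -> coefs_in (p * q).
Proof.
by move=> Sp Sq i; rewrite coefM; apply: subring_sum => j _; apply: subringM.
Qed.

Lemma coefs_in_deriv p : coefs_in p -> coefs_in p^`().
Proof. by move=> Sp i; rewrite coef_deriv; apply: subringMn. Qed.

Lemma coefs_inZXn c k : S c -> coefs_in (c *: 'X^k).
Proof.
move=> Sc i; rewrite coefZ coefXn; case: eqP => _; rewrite ?mulr1 //.
by rewrite mulr0; exact: subring0.
Qed.

End Subring.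

(** Each step of the long division subtracts a multiple of [A] whose quotient term is the leading
    term of [G]; as [A] is monic, no element of [S] is inverted. *)
Lemma coefs_in_modp (F : fieldType) (S : F -> Prop) (A G : {poly F}) :
  subring S -> A \is monic -> coefs_in S A -> coefs_in S G ->
  coefs_in S (G %% A).
Proof.
move=> subS Amon SA; have [k] := ubnP (size G); elim: k G => // k IHk G ltk SG.
have [ltGA|leAG] := ltnP (size G) (size A); first by rewrite modp_small.
have A0 : A != 0 by exact: monic_neq0.
have G0 : (0 < size G)%N by apply: leq_trans leAG; rewrite size_poly_gt0.
pose M := lead_coef G *: 'X^(size G - size A).
have SM : coefs_in S M by apply: coefs_inZXn => //; exact: SG.
have -> : G %% A = (G - M * A) %% A by rewrite modpD modpN modp_mull subr0.
apply: IHk; last by apply: coefs_inB => //; apply: coefs_inM.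
suff : (size (G - M * A)%R < size G)%N by move/leq_trans; apply; rewrite -ltnS.
have G1 : size G = (size G).-1.+1 by rewrite prednK.
have lc0 : lead_coef G != 0 by rewrite lead_coef_eq0 -size_poly_gt0.
have szMA : size (M * A) = size G.
  rewrite size_Mmonic //; last by rewrite scaler_eq0 (negPf lc0) monic_neq0 ?monicXn.
  by rewrite size_scale // size_polyXn addSn /= subnK.
rewrite [X in (_ < X)%N]G1 ltnS; apply/leq_sizeP => j; rewrite leq_eqVlt coefB.
case/orP => [/eqP <-|lt]; last first.
  by rewrite !nth_default ?subrr // ?szMA G1.
have -> : (M * A)`_(size G).-1 = lead_coef (M * A) by rewrite lead_coefE szMA.
rewrite lead_coef_Mmonic // lead_coefZ lead_coefXn mulr1 lead_coefE.
by rewrite subrr.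
Qed.

Section Derivation.
Variables (F : fieldType) (D : F -> F).
Hypothesis DD : forall f g, D (f + g) = D f + D g.
Hypothesis DM : forall f g, D (f * g) = D f * g + f * D g.

Lemma der0 : D 0 = 0.
Proof. by apply: (addrI (D 0)); rewrite -DD !addr0. Qed.

Lemma der1 : D 1 = 0.
Proof.
by apply: (addrI (D 1)); rewrite -{3}[1]mulr1 DM mulr1 mul1r addr0.
Qed.

Lemma derN f : D (- f) = - D f.
Proof. by apply: (addrI (D f)); rewrite -DD !subrr der0. Qed.

Lemma derB f g : D (f - g) = D f - D g.
Proof. by rewrite DD derN. Qed.

Lemma der_sum I (r : seq I) (P : pred I) (f : I -> F) :
  D (\sum_(i <- r | P i) f i) = \sum_(i <- r | P i) D (f i).
Proof. by apply: (big_morph D DD der0). Qed.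

Lemma derV f : f != 0 -> D f^-1 = - D f * f^-1 * f^-1.
Proof.
move=> f0; apply: (mulfI f0); apply: (addrI (D f * f^-1)).
by rewrite -DM divff // der1; field.
Qed.

Lemma derX f k : f * D (f ^+ k) = f ^+ k * D f *+ k.
Proof.
elim: k => [|k IHk]; first by rewrite expr0 der1 mulr0 mulr0n.
rewrite exprS DM mulrDr IHk mulrS mulrnAr; congr (_ + _ *+ k); ring.
Qed.

Lemma coef_map_der p i : (map_poly D p)`_i = D p`_i.
Proof. by rewrite coef_map_id0 // der0. Qed.

Lemma map_derM p q :
  map_poly D (p * q) = map_poly D p * q + p * map_poly D q.
Proof.
apply/polyP => i; rewrite coef_map_der coefD !coefM der_sum -big_split /=.
by apply: eq_bigr => j _; rewrite DM !coef_map_der.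
Qed.

Lemma size_map_der A : A \is monic -> (size (map_poly D A) < size A)%N.
Proof.
move=> Amon; have A0 : (0 < size A)%N by rewrite size_poly_gt0 monic_neq0.
rewrite -[X in (_ < X)%N]prednK // ltnS; apply/leq_sizeP => j.
rewrite coef_map_der leq_eqVlt => /orP [/eqP <-|lt].
  by rewrite -lead_coefE (eqP Amon) der1.
by rewrite nth_default ?der0 // -(prednK A0).
Qed.

(* The derivation extends to the roots y of [A] by the chain rule, D y being
   - (D q) / q' at y, and [q'] is inverted modulo [q] by [V / c]. *)
Lemma der_factor (A B U V : {poly F}) (c : F) :
  A \is monic -> U * (A * B) + V * (A * B)^`() = c%:P ->
  c *: map_poly D A = (V * A^`() * map_poly D (A * B)) %% A.
Proof.
move=> Amon bez; have A0 : A != 0 by exact: monic_neq0.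
(* The leading coefficient 1 has derivative 0, so [map_poly D A] is already reduced modulo [A]. *)
rewrite -[LHS](@modp_small _ _ A); last first.
  by apply: leq_ltn_trans (size_scale_leq _ _) _; exact: size_map_der.
apply/eqP; rewrite -subr_eq0 -modpN -modpD; apply/eqP/modp_eq0P.
rewrite -mul_polyC -bez derivM map_derM.
set DA := map_poly D A; set DB := map_poly D B.
have -> : (U * (A * B) + V * (A^`() * B + A * B^`())) * DA -
  V * A^`() * (DA * B + A * DB)
  = (U * B * DA + V * B^`() * DA - V * A^`() * DB) * A by ring.
exact: dvdp_mulIr.
Qed.

Variable O : F -> Prop.
Hypothesis subO : subring O.

Definition stable_upto (k : nat) (f : F) :=
  forall j, (j <= k)%N -> O (iter j D f).

Definition stable (f : F) := forall j, O (iter j D f).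

Lemma stable_upto0 f : O f -> stable_upto 0 f.
Proof. by move=> Of j; rewrite leqn0 => /eqP ->. Qed.

Lemma stable_uptoS k f : stable_upto k.+1 f <-> O f /\ stable_upto k (D f).
Proof.
split=> [Sf|[Of SDf] [|j] lejk //].
  by split=> [|j lejk]; [exact: (Sf 0%N) | rewrite -iterSr; exact: Sf].
by rewrite iterSr; exact: SDf.
Qed.

Lemma stable_uptoW k f : stable_upto k.+1 f -> stable_upto k f.
Proof. by move=> Sf j lejk; apply: Sf; exact: leqW. Qed.

Lemma stable_uptoP f : stable f <-> forall k, stable_upto k f.
Proof. by split=> [Sf k j _ | Sf j]; [exact: Sf | exact: (Sf j)]. Qed.

(** By the Leibniz rule, the first derivative of a product involves each factor only through
    elements stable to one order less, which is what induction on [k] needs. *)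
Lemma subring_stable_upto k : subring (stable_upto k).
Proof.
have iterDB j f g : iter j D (f - g) = iter j D f - iter j D g.
  by elim: j => //= j ->; rewrite derB.
split=> [|f g Sf Sg j lejk|].
- case: k => [|k]; first by apply: stable_upto0; case: subO.
  apply/stable_uptoS; split; first by case: subO.
  rewrite der1 => j _; have -> : iter j D 0 = 0 by elim: j => //= j ->; exact: der0.
  exact: subring0.
- by rewrite iterDB; apply: subringB; rewrite ?Sf ?Sg //; [exact: Sf|exact: Sg].
- elim: k => [|k IHk] f g Sf Sg.
    by apply: stable_upto0; apply: subringM; [|exact: (Sf 0%N)|exact: (Sg 0%N)].
  have [[Of SDf] [Og SDg]] := (iffLR (stable_uptoS k f) Sf,
                               iffLR (stable_uptoS k g) Sg).
  apply/stable_uptoS; split; first exact: subringM.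
  have iterDD j x y : iter j D (x + y) = iter j D x + iter j D y.
    by elim: j => //= j ->; rewrite DD.
  rewrite DM => j lejk; rewrite iterDD; apply: subringD => //.
    by apply: (IHk (D f) g) => //; exact: stable_uptoW.
  by apply: (IHk f (D g)) => //; exact: stable_uptoW.
Qed.

(** The rule D(1/c) = - D c / c^2 gains one order at a time: its right-hand side is as stable as 1/c
    itself. *)
Lemma stableV c : c != 0 -> O c^-1 -> stable (D c) -> stable c^-1.
Proof.
move=> c0 Oc /stable_uptoP SDc; apply/stable_uptoP; elim=> [|k IHk].
  exact: stable_upto0.
apply/stable_uptoS; split=> //; rewrite derV //.
have subk := subring_stable_upto k.
apply: (subringM subk) => //; apply: (subringM subk) => //.
by apply: (subringN subk); exact: SDc.
Qed.

(** Induction on the order: [der_factor] writes the derivatives of the coefficients of [A] through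
    stable data and these coefficients themselves, and reduction modulo the monic [A] stays inside
    the subring of elements stable up to order [k]. *)
Lemma stable_factor (A B U V : {poly F}) (c : F) :
  A \is monic -> U * (A * B) + V * (A * B)^`() = c%:P -> c != 0 ->
  O c^-1 -> stable (D c) -> coefs_in stable V ->
  coefs_in stable (map_poly D (A * B)) -> coefs_in O A -> coefs_in stable A.
Proof.
move=> Amon bez c0 Oc SDc SV SDq OA i; apply/stable_uptoP => k.
have {Oc SDc}Sc := stableV c0 Oc SDc.
elim: k i => [|k IHk] i; first exact: stable_upto0.
apply/stable_uptoS; split=> //; have subk := subring_stable_upto k.
have -> : D A`_i = c^-1 * ((V * A^`() * map_poly D (A * B)) %% A)`_i.
  by rewrite -(der_factor Amon bez) coefZ coef_map_der mulKf.
apply: (subringM subk); first exact: (iffLR (stable_uptoP _)).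
apply: (coefs_in_modp subk) => //; apply: (coefs_inM subk).
  apply: (coefs_inM subk); last exact: coefs_in_deriv.
  by move=> j; exact: (iffLR (stable_uptoP _)).
by move=> j; exact: (iffLR (stable_uptoP _)).
Qed.

(** For [c != 0] in [O], this is the ring O[1/c], described without inverses. *)
Definition localized (c f : F) := exists N, O (c ^+ N * f).

Lemma sub_localized c f : O f -> localized c f.
Proof. by move=> Of; exists 0%N; rewrite expr0 mul1r. Qed.

Lemma subring_localized c : O c -> subring (localized c).
Proof.
move=> Oc; split; first by apply: sub_localized; case: subO.
- move=> f g [M Of] [N Og]; exists (M + N)%N.
  have -> : c ^+ (M + N) * (f - g) =
    c ^+ N * (c ^+ M * f) - c ^+ M * (c ^+ N * g) by rewrite exprD; ring.
  by apply: subringB => //; apply: subringM => //; exact: subringX.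
- move=> f g [M Of] [N Og]; exists (M + N)%N.
  have -> : c ^+ (M + N) * (f * g) = (c ^+ M * f) * (c ^+ N * g).
    by rewrite exprD; ring.
  exact: subringM.
Qed.

(** The identity c^(N+1) D f = c D(c^N f) - N c^N f D c only uses [D] multiplied by [c] on elements
    of [O]. *)
Lemma der_localized c f : O c -> O (D c) ->
  (forall g, O g -> O (c * D g)) -> localized c f -> localized c (D f).
Proof.
move=> Oc ODc OD [N Of]; exists N.+1.
have -> : c ^+ N.+1 * D f = c * D (c ^+ N * f) - (c ^+ N * f) * D c *+ N.
  by rewrite DM mulrDr [c * (D _ * f)]mulrA derX exprS -!mulrnAl; ring.
apply: subringB => //; first exact: OD.
by apply: subringMn => //; apply: subringM.
Qed.

End Derivation.

(** * The derivation of the field of fractions *)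

Local Notation "p %:F" := (tofrac p).

Lemma fraction_denom (A : idomainType) (f : {fraction A}) :
  f * (\d_(repr f))%:F = (\n_(repr f))%:F.
Proof.
rewrite -{1}[f]reprK; unlock tofrac; rewrite -[LHS]FracField.pi_mul /FracField.mulf.
rewrite !numden_Ratio ?oner_eq0 // mulr1.
apply/eqmodP; rewrite /= FracField.equivfE !numden_Ratio ?oner_eq0 ?denom_ratioP //.
by rewrite mulr1 mulrC.
Qed.

Section FractionDerivation.
(* [F] stands for the field of fractions of {poly K}. *)
Variables (K F : fieldType) (tau : {rmorphism {poly K} -> F}).
Variables (num den : F -> {poly K}).
Hypothesis tau_eq0 : forall p, (tau p == 0) = (p == 0).
Hypothesis den_neq0 : forall f, den f != 0.
Hypothesis num_den : forall f, f * tau (den f) = tau (num f).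
Implicit Types (u v p : {poly K}) (f g : F).

Lemma tau_inj : injective tau.
Proof.
by move=> p q pq; apply/eqP; rewrite -subr_eq0 -tau_eq0 rmorphB /= pq subrr.
Qed.

Lemma fraction_ex f : exists u v, v != 0 /\ f * tau v = tau u.
Proof.
by exists (num f), (den f).
Qed.

Lemma fraction_coprime_ex f :
  exists u v, [/\ v != 0, coprimep u v & f * tau v = tau u].
Proof.
have [u [v [v0 fE]]] := fraction_ex f; pose g := gcdp u v.
have g0 : g != 0 by rewrite gcdp_eq0 negb_and v0 orbT.
have gu : u = u %/ g * g by rewrite divpK ?dvdp_gcdl.
have gv : v = v %/ g * g by rewrite divpK ?dvdp_gcdr.
exists (u %/ g), (v %/ g); split.
- by apply: contraNneq v0 => vg; rewrite gv vg mul0r.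
- by apply: coprimep_div_gcd; rewrite v0 orbT.
- have gF0 : tau g != 0 by rewrite tau_eq0.
  by apply: (mulIf gF0); rewrite -mulrA -!rmorphM -gu -gv.
Qed.

Definition fraction_der f : F :=
  (tau (num f)^`() - f * tau (den f)^`()) / tau (den f).

(** The quotient rule is independent of the representative: differentiate the relation
    [u * d = n * v] between two fractions for [f]. *)
Lemma fraction_derE f u v : v != 0 -> f * tau v = tau u ->
  fraction_der f * tau v = tau u^`() - f * tau v^`().
Proof.
move=> v0 fE; rewrite /fraction_der.
have := num_den f; have := den_neq0 f.
set n := num f; set d := den f => d0 nE.
have dF0 : tau d != 0 by rewrite tau_eq0.
have vF0 : tau v != 0 by rewrite tau_eq0.
have uvE : u * d = n * v.
  by apply: tau_inj; rewrite !rmorphM -fE -nE mulrAC.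
have /(congr1 (fun p => tau (deriv p))) := uvE.
rewrite !derivM !rmorphD !rmorphM -fE -nE => duv.
move: duv => /(canRL (addrK _)) => duE.
apply: (mulIf dF0); rewrite mulrAC divfK // [RHS]mulrBl duE; ring.
Qed.

Lemma fraction_der_tofrac p : fraction_der (tau p) = tau p^`().
Proof.
have := @fraction_derE (tau p) p 1 (oner_neq0 _).
by rewrite rmorph1 !mulr1 => -> //; rewrite -[1]/(1%:P) derivC rmorph0 mulr0 subr0.
Qed.

Lemma fraction_derD f g : fraction_der (f + g) = fraction_der f + fraction_der g.
Proof.
have [u [v [v0 fE]]] := fraction_ex f; have [w [x [x0 gE]]] := fraction_ex g.
have vx0 : v * x != 0 by rewrite mulf_neq0.
have fgE : (f + g) * tau (v * x) = tau (u * x + w * v).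
  by rewrite rmorphD !rmorphM -fE -gE; ring.
have := fraction_derE vx0 fgE.
rewrite derivD !derivM !rmorphD !rmorphM -fE -gE => dfg.
apply: (mulIf (_ : tau (v * x) != 0)); first by rewrite tau_eq0.
rewrite rmorphM dfg; have := fraction_derE v0 fE; have := fraction_derE x0 gE.
move=> /esym/(canRL (subrK _)) -> /esym/(canRL (subrK _)) ->; ring.
Qed.

Lemma fraction_derM f g :
  fraction_der (f * g) = fraction_der f * g + f * fraction_der g.
Proof.
have [u [v [v0 fE]]] := fraction_ex f; have [w [x [x0 gE]]] := fraction_ex g.
have vx0 : v * x != 0 by rewrite mulf_neq0.
have fgE : (f * g) * tau (v * x) = tau (u * w).
  by rewrite !rmorphM -fE -gE; ring.
have := fraction_derE vx0 fgE.
rewrite !derivM !rmorphD !rmorphM -fE -gE => dfg.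
apply: (mulIf (_ : tau (v * x) != 0)); first by rewrite tau_eq0.
rewrite rmorphM dfg; have := fraction_derE v0 fE; have := fraction_derE x0 gE.
move=> /esym/(canRL (subrK _)) -> /esym/(canRL (subrK _)) ->; ring.
Qed.

Hypothesis charK : [pchar K] =i pred0.

Lemma natr_neq0 k : k.+1%:R != 0 :> K.
Proof. by move/pcharf0P: charK => ->. Qed.

Lemma size_deriv0 p : size p^`() = (size p).-1.
Proof.
have [p0|p0] := eqVneq (size p) 0%N.
  by move/eqP: p0; rewrite size_poly_eq0 => /eqP ->; rewrite deriv0 size_poly0.
apply/eqP; rewrite eqn_leq; apply/andP; split.
  apply/leq_sizeP => j lej; rewrite coef_deriv nth_default ?mul0rn //.
  by move: p0 lej; case: (size p).
case E : (size p) p0 => [|[|k]] // _ /=; rewrite ltnNge; apply/negP => /leq_sizeP le.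
have := le k (leqnn _); rewrite coef_deriv -mulr_natr => /eqP.
rewrite mulf_eq0 (negPf (natr_neq0 k)) orbF => /eqP pk.
have : lead_coef p = 0 by rewrite lead_coefE E.
by move/eqP; rewrite lead_coef_eq0 -size_poly_eq0 E.
Qed.

(** For u/v in lowest terms, u' v = u v' makes v divide v', which has smaller degree; hence v' = 0,
    then u' = 0, and characteristic zero makes both constant. *)
Lemma fraction_der_eq0 f : fraction_der f = 0 -> exists c, f = tau c%:P.
Proof.
move=> Df; have [u [v [v0 copuv fE]]] := fraction_coprime_ex f.
have := fraction_derE v0 fE; rewrite Df mul0r => /esym/(canRL (subrK _)).
rewrite add0r => /(congr1 (fun g => g * tau v)); rewrite mulrAC fE -!rmorphM.
move/tau_inj => duv.
have v'0 : v^`() = 0.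
  apply: contraTeq (leqnn (size v)) => v'0; rewrite -ltnNge.
  have : v %| v^`().
    by rewrite -(Gauss_dvdpr _ (_ : coprimep v u)) 1?coprimep_sym // -duv dvdp_mull.
  move/(dvdp_leq v'0); rewrite size_deriv0 => le.
  by apply: leq_ltn_trans le _; rewrite ltn_predL size_poly_gt0.
have u'0 : u^`() = 0.
  by apply/eqP; move: duv; rewrite v'0 mulr0 => /eqP; rewrite mulf_eq0 (negPf v0) orbF.
have cst p : p^`() = 0 -> p = (p`_0)%:P.
  move=> p'0; apply: size1_polyC; have := size_deriv0 p.
  by rewrite p'0 size_poly0; case: (size p) => [|[]].
have vc : v`_0 != 0 by apply: contraNneq v0 => vc; rewrite (cst v v'0) vc.
exists (u`_0 / v`_0); apply: (mulIf (_ : tau v != 0)); first by rewrite tau_eq0.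
by rewrite fE -rmorphM (cst v v'0) (cst u u'0) !coefC !eqxx -polyCM divfK.
Qed.

End FractionDerivation.

(** * Wronskians and separable pencils *)

Section Wronskian.
Variables (K : fieldType).
Hypothesis charK : [pchar K] =i pred0.
Implicit Types p q : {poly K}.

(** The numerator of the derivative of p/q over the denominator q^2. *)
Definition wronskian p q := p^`() * q - p * q^`().

(** Writing p = S q + r splits off the term S' q^2, which dominates because S is not constant and
    the characteristic is zero. In degrees: deg p + deg q - 1. *)
Lemma size_wronskian p q : q != 0 -> (size q < size p)%N ->
  (size (wronskian p q)).+2 = (size p + size q)%N.
Proof.
move=> q0 ltqp; pose S := p %/ q; pose r := p %% q.
have pE : p = S * q + r by exact: divp_eq.
have rq : (size r < size q)%N by rewrite ltn_modp.
have q1 : (0 < size q)%N by rewrite size_poly_gt0.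
have sS : size S = (size p - (size q).-1)%N by exact: size_divp.
have sS' : size S^`() = (size S).-1 by exact: size_deriv0.
have S'0 : S^`() != 0.
  by rewrite -size_poly_gt0 sS' sS; move: (size p) (size q) ltqp q1 => a b; lia.
have sm : size (S^`() * (q * q)) = (size p + size q).-2.
  rewrite size_mul ?mulf_neq0 // size_mul // sS' sS.
  by move: ltqp q1; move: (size p) (size q) => a b; lia.
have -> : wronskian p q = S^`() * (q * q) + wronskian r q.
  by rewrite /wronskian pE !derivE; ring.
have lt2 : (2 < size p + size q)%N.
  by move: ltqp q1; move: (size p) (size q) => a b; lia.
rewrite size_polyDl ?sm; first by move: lt2; move: (_ + _)%N => a; lia.
apply: leq_ltn_trans (_ : (size q + size q).-2 < _)%N; last first.
  by move: ltqp q1; move: (size p) (size q) => a b; lia.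
apply: leq_trans (size_polyD _ _) _; rewrite size_polyN geq_max; apply/andP; split.
  have [->|r'0] := eqVneq r^`() 0; first by rewrite mul0r size_poly0.
  rewrite size_mul // size_deriv0 //; move: r'0 rq; rewrite -size_poly_gt0 size_deriv0 //.
  by move: (size r) (size q) => a b; lia.
apply: leq_trans (size_polyMleq _ _) _; rewrite size_deriv0 //.
by move: rq q1; move: (size r) (size q) => a b; lia.
Qed.

(** In characteristic zero, differentiation lowers the multiplicity of a root by exactly one, so the
    gcd with q' cannot absorb the root entirely. *)
Lemma root_div_gcdp_deriv q z : q != 0 -> root q z ->
  root (q %/ gcdp q q^`()) z.
Proof.
move=> q0 qz; set g := gcdp q q^`().
have qE : q = q %/ g * g by rewrite divpK ?dvdp_gcdl.
have g0 : g != 0 by rewrite gcdp_eq0 negb_and q0.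
case: (multiplicity_XsubC q z) => -[|m] [c]; rewrite q0 /= => cz cE.
  by rewrite cE expr0 mulr1 (negPf cz) in qz.
have mupX k : mup z (c * ('X - z%:P) ^+ k) = k.
  by rewrite mupMr // mup_XsubCX eqxx.
apply/negPn/negP => rz; have : ('X - z%:P) ^+ m.+1 %| g.
  by rewrite -mup_geq // -(mupMr _ rz) -qE cE mupX.
move/dvdp_trans/(_ (dvdp_gcdr _ _)); rewrite cE derivM deriv_exp derivXsubC mul1r.
rewrite dvdp_addr; last exact: dvdp_mull.
rewrite mulrnAr -scaler_nat /=.
rewrite dvdpZr ?natr_neq0 // -mup_geq ?mupX ?ltnn // mulf_neq0 //.
  by apply: contraNneq cz => ->; exact: root0.
by rewrite expf_neq0 // polyXsubC_eq0.
Qed.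

End Wronskian.

Section WronskianClosed.
Variables (K : closedFieldType).
Hypothesis charK : [pchar K] =i pred0.
Implicit Types p q : {poly K}.

(** Both the wronskian and the numerator of the derivative of u/q^k contain g = gcd(q, q'). The
    remaining factor [W1] of the wronskian is coprime to q: at a root of q, [r] vanishes while p and
    [s] do not. So the power of q can be cancelled. *)
Lemma wronskian_dvd_deriv p q u k j (w : {poly K}) : q != 0 -> coprimep p q ->
  w * wronskian p q = (u^`() * q - u * q^`() *+ k) * q ^+ j ->
  wronskian p q %| u^`() * q - u * q^`() *+ k.
Proof.
move=> q0 copq wE; pose g := gcdp q q^`(); pose r := q %/ g; pose s := q^`() %/ g.
have qE : q = r * g by rewrite divpK ?dvdp_gcdl.
have q'E : q^`() = s * g by rewrite divpK ?dvdp_gcdr.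
have g0 : g != 0 by rewrite gcdp_eq0 negb_and q0.
have coprs : coprimep r s by apply: coprimep_div_gcd; rewrite q0.
pose W1 := p^`() * r - p * s; pose N1 := u^`() * r - u * s *+ k.
have WE : wronskian p q = W1 * g by rewrite /wronskian q'E {1}qE /W1; ring.
have NE : u^`() * q - u * q^`() *+ k = N1 * g.
  by rewrite q'E {1}qE /N1 mulrBl mulrnAl; congr (_ - _ *+ k); ring.
have copW : coprimep W1 (q ^+ j); last first.
  rewrite WE NE dvdp_mul2r // -(Gauss_dvdpl _ copW).
  move: wE; rewrite WE NE mulrA [RHS]mulrAC => /(mulIf g0) <-.
  exact: dvdp_mulIr.
apply/coprimep_expr; rewrite coprimep_sym; apply: Pdiv.ClosedField.root_coprimep => z qz.
have rz : r.[z] = 0 by apply/rootP; exact: root_div_gcdp_deriv.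
have pz : p.[z] != 0 by rewrite coprimep_sym in copq; exact: coprimep_root qz.
rewrite /W1 !hornerE rz mulr0 sub0r oppr_eq0 mulf_neq0 //.
by apply: coprimep_root coprs _; exact/rootP.
Qed.

End WronskianClosed.

(** * The discriminant of a pencil p1 - T p2 *)

Section Discriminant.
Variable K : closedFieldType.
Hypothesis charK : [pchar K] =i pred0.
Implicit Types p q : {poly K}.

(* The polynomial p1(Y) - T p2(Y), with outer variable Y and inner variable T. *)
Definition pencil p1 p2 : {poly {poly K}} := p1^:P - 'X *: p2^:P.

Lemma map_pencil (t0 : K) p1 p2 :
  map_poly (horner_eval t0) (pencil p1 p2) = p1 - t0 *: p2.
Proof.
rewrite rmorphB /= map_polyZ -!map_poly_comp /= [X in X *: _]hornerX.
by rewrite !map_poly_id // => c _ /=; rewrite /horner_eval hornerC.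
Qed.

(** Take for [d] the resultant in Y of the pencil and its derivative. Both leading coefficients in Y
    are constants, because deg p2 < deg p1, so specializing T at [t0] commutes with the
    resultant. *)
Lemma discriminant_ex p1 p2 : (size p2 < size p1)%N -> (1 < size p1)%N ->
  exists (d : {poly K}) (U V : {poly {poly K}}),
    U * pencil p1 p2 + V * (pencil p1 p2)^`() = d%:P /\
    forall t0, separable_poly (p1 - t0 *: p2) -> d.[t0] != 0.
Proof.
move=> lt21 p1_gt1; set q := pencil p1 p2.
have szq : size q = size p1.
  rewrite /q /pencil size_polyDl size_map_polyC // size_polyN.
  by apply: leq_ltn_trans (size_scale_leq _ _) _; rewrite size_map_polyC.
have lcq : lead_coef q = (lead_coef p1)%:P.
  rewrite lead_coefE szq coefB coefZ !coef_map /= lead_coefE [p2`_ _]nth_default ?mulr0 ?subr0 //.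
  by rewrite -ltnS prednK // (ltn_trans _ p1_gt1).
have lc0 : lead_coef p1 != 0 by rewrite lead_coef_eq0 -size_poly_gt0 (ltn_trans _ p1_gt1).
have q'E k : q^`()`_k = q`_k.+1 *+ k.+1 by rewrite coef_deriv.
have q'top : q^`()`_(size p1).-2 = (lead_coef p1 *+ (size p1).-1)%:P.
  rewrite q'E; have -> : (size p1).-2.+1 = (size p1).-1 by case: (size p1) p1_gt1 => [|[]].
  by rewrite -szq -lead_coefE lcq polyCMn.
have nz : lead_coef p1 *+ (size p1).-1 != 0.
  case: (size p1) p1_gt1 => [|[|k]] //= _.
  by rewrite -mulr_natr mulf_neq0 // natr_neq0.
have szq' : size q^`() = (size p1).-1.
  apply/eqP; rewrite eqn_leq; apply/andP; split.
    apply/leq_sizeP => j lej; rewrite q'E nth_default ?mul0rn // szq.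
    by case: (size p1) lej.
  rewrite leqNgt; apply/negP => lt; move: q'top; rewrite nth_default; last first.
    by case: (size p1) lt p1_gt1 => [|[]].
  by move/esym/eqP; rewrite polyC_eq0 (negPf nz).
have lcq' : lead_coef q^`() = (lead_coef p1 *+ (size p1).-1)%:P.
  by rewrite lead_coefE szq' q'top.
(* For a pencil of degree 1 in Y the derivative is a nonzero constant and serves as [d];
   [resultant_in_ideal] requires both degrees to be positive. *)
have [gt1|le1] := ltnP 1 (size q^`()); last first.
  have sz2 : (size p1).-2 = 0%N.
    by move: le1; rewrite szq'; case: (size p1) => [|[|[|]]].
  exists (lead_coef p1 *+ (size p1).-1)%:P, 0, 1; split=> [|t0 _].
    by rewrite mul0r add0r mul1r (size1_polyC le1) -q'top sz2.
  by rewrite hornerC.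
have q_gt1 : (1 < size q)%N by rewrite szq.
have [[U V] /= _ bez] := resultant_in_ideal q_gt1 gt1.
exists (resultant q q^`()), U, V; split=> [|t0 sep]; first by rewrite -bez.
have ev := @map_resultant _ _ (horner_eval t0) q q^`().
move: ev; rewrite lcq lcq' /= /horner_eval !hornerC -/(horner_eval t0) => -> //.
rewrite -deriv_map map_pencil resultant_eq0 -leqNgt.
by move: sep; rewrite separable_poly.unlock /coprimep => /eqP ->.
Qed.

End Discriminant.

Lemma wronskian_neq0 (K : fieldType) (p q : {poly K}) : [pchar K] =i pred0 ->
  q != 0 -> (size q < size p)%N -> wronskian p q != 0.
Proof.
move=> charK q0 lt; rewrite -size_poly_gt0; have := size_wronskian charK q0 lt.
move: q0 lt; rewrite -size_poly_gt0.
by move: (size (wronskian p q)) (size p) (size q) => a b c; lia.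
Qed.

Section SeparablePencil.
Variable K : closedFieldType.
Hypothesis charK : [pchar K] =i pred0.
Implicit Types p q : {poly K}.

Lemma closed_avoid (s : seq K) : exists x, x \notin s.
Proof.
have : \prod_(z <- s) ('X - z%:P) != 0 :> {poly K}.
  by rewrite monic_neq0 // monic_prod_XsubC.
by case/closed_nonrootP => x; rewrite root_prod_XsubC; exists x.
Qed.

(** A multiple root of p1 - t0 p2 is a zero of the wronskian, and t0 is then the value of p1/p2
    there; only finitely many values arise. *)
Lemma separable_pencil p1 p2 : wronskian p1 p2 != 0 -> coprimep p1 p2 ->
  exists s : seq K, forall t0, t0 \notin s -> separable_poly (p1 - t0 *: p2).
Proof.
move=> W0 cop; have [r Wr] := closed_field_poly_normal (wronskian p1 p2).
exists [seq p1.[z] / p2.[z] | z <- r] => t0 t0r; rewrite separable_poly.unlock.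
apply: Pdiv.ClosedField.root_coprimep => z; rewrite rootE !hornerE => /eqP pz.
apply: contra t0r; rewrite derivB derivZ !hornerE => /eqP dz.
have p1z : p1.[z] = t0 * p2.[z] by apply/eqP; rewrite -subr_eq0 pz.
have p1'z : p1^`().[z] = t0 * p2^`().[z] by apply/eqP; rewrite -subr_eq0 dz.
have zr : z \in r.
  rewrite -root_prod_XsubC -(rootZ _ _ (_ : lead_coef (wronskian p1 p2) != 0)).
    by rewrite -Wr rootE /wronskian !hornerE p1z p1'z; apply/eqP; ring.
  by rewrite lead_coef_eq0.
apply/mapP; exists z => //; rewrite p1z mulfK //.
apply/negP => p2z; have p1z0 : root p1 z by rewrite rootE p1z (eqP p2z) mulr0.
by have := coprimep_root cop p1z0; rewrite p2z.
Qed.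

Lemma separable_pencil_ex p q : q != 0 -> coprimep p q -> (size q < size p)%N ->
  exists t0, separable_poly (p - t0 *: q).
Proof.
move=> q0 cop lt; have W0 : wronskian p q != 0 by exact: wronskian_neq0.
have [s sep] := separable_pencil W0 cop; have [t0 t0s] := closed_avoid s.
by exists t0; exact: sep.
Qed.

End SeparablePencil.

(** * Functions on the line regular away from the poles of P *)

Section RegularFunctions.
Variables (K : closedFieldType) (F : fieldType) (tau : {rmorphism {poly K} -> F}).
Variables (num den : F -> {poly K}).
Hypothesis charK : [pchar K] =i pred0.
Hypothesis tau_eq0 : forall p, (tau p == 0) = (p == 0).
Hypothesis den_neq0 : forall f, den f != 0.
Hypothesis num_den : forall f, f * tau (den f) = tau (num f).
Variables (P1 P2 : {poly K}).
Hypothesis P2_neq0 : P2 != 0.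
Hypothesis copP : coprimep P1 P2.
Hypothesis ltP : (size P2 < size P1)%N.
Implicit Types (u v p : {poly K}) (f g : F).

Let t : F := tau P1 / tau P2.
Let D0 : F -> F := fraction_der tau num den.
Let W := wronskian P1 P2.

Let D0E := fraction_derE tau_eq0 den_neq0 num_den.

(* The derivation d/dt. *)
Definition line_der f := D0 f / D0 t.

(** The substitution of t for T, which identifies K[T] with the subring K[t] of [F]. *)
Definition pullback_poly : {poly K} -> F :=
  horner_eval t \o map_poly (tau \o polyC).
HB.instance Definition _ := GRing.RMorphism.on pullback_poly.

Let tauP2 : tau P2 != 0. Proof. by rewrite tau_eq0. Qed.

Let W_neq0 : W != 0. Proof. exact: wronskian_neq0. Qed.

Lemma D0t_wronskian : D0 t * tau P2 ^+ 2 = tau W.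
Proof.
have tP2 : t * tau P2 = tau P1 by rewrite divfK.
have := D0E P2_neq0 tP2; rewrite -/D0 => e.
by rewrite expr2 mulrA e mulrBl mulrAC tP2 -!rmorphM -rmorphB.
Qed.

Lemma D0t_neq0 : D0 t != 0.
Proof.
have : tau W != 0 by rewrite tau_eq0 W_neq0.
by rewrite -D0t_wronskian mulf_eq0 => /norP[].
Qed.

Lemma line_derD f g : line_der (f + g) = line_der f + line_der g.
Proof.
by rewrite /line_der /D0 (fraction_derD tau_eq0 den_neq0 num_den) mulrDl.
Qed.

Lemma line_derM f g : line_der (f * g) = line_der f * g + f * line_der g.
Proof.
by rewrite /line_der /D0 (fraction_derM tau_eq0 den_neq0 num_den) mulrDl mulrAC mulrA.
Qed.

Lemma line_der_cst c : line_der (tau c%:P) = 0.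
Proof.
rewrite /line_der /D0 (fraction_der_tofrac tau_eq0 den_neq0 num_den).
by rewrite derivC rmorph0 mul0r.
Qed.

Lemma line_der_t : line_der t = 1.
Proof. by rewrite /line_der divff // D0t_neq0. Qed.

Lemma pullback_polyX : pullback_poly 'X = t.
Proof. by rewrite /pullback_poly /= map_polyX /horner_eval hornerX. Qed.

Lemma pullback_polyC c : pullback_poly c%:P = tau c%:P.
Proof. by rewrite /pullback_poly /= map_polyC /horner_eval hornerC. Qed.

Lemma line_der_pullback G : line_der (pullback_poly G) = pullback_poly G^`().
Proof.
elim/poly_ind: G => [|G c IHG].
  by rewrite deriv0 !rmorph0 (der0 line_derD).
rewrite derivD derivM derivX derivC mulr1 addr0 !rmorphD !rmorphM /=.
rewrite pullback_polyX pullback_polyC line_derD line_derM IHG line_der_t.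
by rewrite line_der_cst addr0 mulr1.
Qed.

(** This is the transcendence of t over K: splitting off the roots of G one by one leaves t
    different from every constant z, and P1 = z P2 contradicts the degrees. *)
Lemma pullback_poly_eq0 G : (pullback_poly G == 0) = (G == 0).
Proof.
apply/idP/idP => [|/eqP ->]; last by rewrite rmorph0.
have [k] := ubnP (size G); elim: k G => // k IHk G ltk; apply: contraTT => G0.
have [/eqP sz1|/closed_rootP [z /factor_theorem [G1 GE]]] := boolP (size G == 1%N).
  have Gc : G = (G`_0)%:P by apply: size1_polyC; rewrite sz1.
  by rewrite Gc pullback_polyC tau_eq0 -Gc.
have G1_0 : G1 != 0 by apply: contraNneq G0 => G10; rewrite GE G10 mul0r.
rewrite GE rmorphM mulf_neq0 //.
  apply: (contraNN _ (G1_0)); apply: IHk; move: ltk.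
  by rewrite GE size_Mmonic ?monicXsubC // size_XsubC addn2.
rewrite rmorphB /= pullback_polyX pullback_polyC subr_eq0.
apply/eqP => tz; have /(congr1 (fun p : {poly K} => size p)) : P1 = z%:P * P2.
  by apply: (tau_inj tau_eq0); rewrite rmorphM /= -tz divfK.
rewrite mul_polyC => e; move: ltP; rewrite e ltnNge.
by rewrite size_scale_leq.
Qed.

(** The ring K[x][1/P2]. Poles at infinity are allowed, as P has a pole there by [ltP]. *)
Definition regular f := exists k u, f * tau P2 ^+ k = tau u.

Lemma regular_tau u : regular (tau u).
Proof. by exists 0%N, u; rewrite expr0 mulr1. Qed.

Lemma subring_regular : subring regular.
Proof.
split=> [|f g [k [u fE]] [l [v gE]]|f g [k [u fE]] [l [v gE]]].
- by rewrite -(rmorph1 tau); exact: regular_tau.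
- exists (k + l)%N, (u * P2 ^+ l - v * P2 ^+ k).
  by rewrite rmorphB !rmorphM !rmorphXn -fE -gE exprD; ring.
- by exists (k + l)%N, (u * v); rewrite rmorphM -fE -gE exprD; ring.
Qed.

Lemma regular_divX f k : regular (f * tau P2 ^+ k) -> regular f.
Proof.
by move=> [l [u fE]]; exists (k + l)%N, u; rewrite exprD mulrA.
Qed.

Lemma regular_t : regular t.
Proof. by exists 1%N, P1; rewrite expr1 divfK. Qed.

Lemma regular_pullback G : regular (pullback_poly G).
Proof.
elim/poly_ind: G => [|G c IHG].
  by rewrite rmorph0; exact: subring0 subring_regular.
rewrite rmorphD rmorphM /= pullback_polyX pullback_polyC.
apply: (subringD subring_regular); last exact: regular_tau.
by apply: (subringM subring_regular) => //; exact: regular_t.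
Qed.

(** The quotient rule for u/P2^k, divided by the derivative W/P2^2 of t and cleared of
    denominators. *)
Lemma line_derE f u k : f * tau P2 ^+ k = tau u ->
  line_der f * tau W * tau P2 ^+ k = tau (u^`() * P2 - u * P2^`() *+ k) * tau P2.
Proof.
move=> fE; have P2k0 : P2 ^+ k != 0 by rewrite expf_neq0.
have fE' : f * tau (P2 ^+ k) = tau u by rewrite rmorphXn.
have := D0E P2k0 fE'; rewrite -/D0 => dE.
apply: (mulIf tauP2).
have -> : line_der f * tau W * tau P2 ^+ k * tau P2 =
    (D0 f * tau (P2 ^+ k)) * tau P2 ^+ 3.
  have -> : D0 f = line_der f * D0 t by rewrite divfK // D0t_neq0.
  by rewrite -D0t_wronskian rmorphXn /=; ring.
have eX : (P2 ^+ k)^`() * P2 = P2^`() * P2 ^+ k *+ k.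
  rewrite deriv_exp; case: (k) => [|l]; first by rewrite !mulr0n mul0r.
  by rewrite mulrnAl -mulrA -exprSr.
transitivity ((tau u^`() * tau P2 - f * tau ((P2 ^+ k)^`() * P2)) * tau P2 ^+ 2).
  by rewrite dE rmorphM /=; ring.
have -> : f * tau ((P2 ^+ k)^`() * P2) = tau (u * P2^`()) *+ k.
  rewrite eX rmorphMn /= mulrnAr; congr (_ *+ _).
  by rewrite !rmorphM /= -fE'; ring.
by rewrite rmorphB rmorphMn !rmorphM /=; ring.
Qed.

(* Since deg P2 < deg P1, these are the [f] with f / t ^ k finite over t = oo. *)
Definition pole_le k f :=
  exists2 u : {poly K}, (size u <= k * (size P1).-1 + 1)%N & f * tau P2 ^+ k = tau u.

Lemma regular_pole_le f : regular f -> exists k, pole_le k f.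
Proof.
(* Each further factor P2 raises the degree by deg P2 and the bound by deg P1, which is larger;
   [size u] further factors therefore suffice. *)
move=> [k [u fE]]; exists (k + size u)%N, (u * P2 ^+ size u).
  apply: leq_trans (size_polyMleq _ _) _.
  have := size_exp P2 (size u); move: (size (P2 ^+ _)) => c.
  move: P2_neq0 ltP; rewrite -size_poly_gt0.
  move: (size u) (size P1) (size P2) => a b d; clear; nia.
by rewrite exprD mulrA fE rmorphM rmorphXn.
Qed.

Lemma pole_le0 f : pole_le 0 f -> exists c, f = tau c%:P.
Proof.
move=> [u]; rewrite mul0n add0n expr0 mulr1 => le1 ->.
by exists u`_0; rewrite -size1_polyC.
Qed.

(** Regularity makes the wronskian W divide the numerator N of the derivative. Since deg N is at
    most deg u + deg P2 - 1 and deg W = deg P1 + deg P2 - 1, the quotient has degree at most deg u -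
    deg P1. *)
Lemma pole_le_der k f : pole_le k.+1 f -> regular (line_der f) ->
  pole_le k (line_der f).
Proof.
move=> [u szu fE] [j [w dfE]]; have dE := line_derE fE.
pose N := u^`() * P2 - u * P2^`() *+ k.+1.
have {}dE : line_der f * tau W * tau P2 ^+ k = tau N.
  by apply: (mulIf tauP2); rewrite -dE exprSr mulrA.
have wE : (w * P2 ^+ k) * W = N * P2 ^+ j.
  by apply: (tau_inj tau_eq0); rewrite !rmorphM !rmorphXn /= -dfE -dE; ring.
have /dvdpP [u1 NE] := wronskian_dvd_deriv charK P2_neq0 copP wE.
have u1E : line_der f * tau P2 ^+ k = tau u1.
  apply: (mulIf (_ : tau W != 0)); first by rewrite tau_eq0 W_neq0.
  by rewrite mulrAC dE -rmorphM; congr (tau _).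
exists u1 => //; have [->|u1_0] := eqVneq u1 0; first by rewrite size_poly0.
have N0 : N != 0 by rewrite /N NE mulf_neq0 // W_neq0.
have u0 : u != 0.
  by apply: contraNneq (N0) => u0; rewrite /N u0 deriv0 !mul0r mul0rn subr0.
have szN : (size N + 2 <= size u + size P2)%N.
  (* The [maxn 2] accommodates a vanishing derivative. *)
  have le1 : (size (u^`() * P2)%R + 2 <= maxn 2 (size u + size P2))%N.
    have [->|u'0] := eqVneq u^`() 0; first by rewrite mul0r size_poly0 leq_maxl.
    rewrite size_mul // size_deriv0 //; move: u'0 P2_neq0.
    rewrite -!size_poly_gt0 size_deriv0 //.
    by move: (size u) (size P2) => a b; lia.
  have le2 : (size (u * P2^`())%R + 2 <= maxn 2 (size u + size P2))%N.
    have [->|P2'0] := eqVneq P2^`() 0; first by rewrite mulr0 size_poly0 leq_maxl.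
    rewrite size_mul // size_deriv0 //; move: P2'0 u0.
    rewrite -!size_poly_gt0 size_deriv0 //.
    by move: (size u) (size P2) => a b; lia.
  have leN : (size N <= maxn (size (u^`() * P2)%R) (size (u * P2^`())%R))%N.
    apply: leq_trans (size_polyD _ _) _; rewrite size_polyN geq_max leq_maxl /=.
    by rewrite -scaler_nat (leq_trans (size_scale_leq _ _)) // leq_maxr.
  move: N0 le1 le2 leN; rewrite -size_poly_gt0.
  move: (size N) (size (u^`() * P2)%R) (size (u * P2^`())%R) (size u) (size P2) => a b c d e.
  by clear; lia.
have := size_wronskian charK P2_neq0 ltP; rewrite -/W => szW.
have := size_mul u1_0 W_neq0; rewrite -NE -/N => szN'.
have : (0 < size u1)%N by rewrite size_poly_gt0.
have : (0 < size W)%N by rewrite size_poly_gt0 W_neq0.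
move: szN szW szN' szu ltP.
move: (size N) (size W) (size u) (size u1) (size P1) (size P2) => a b c d e g.
by clear; nia.
Qed.

Lemma antiderivative_ex (G : {poly K}) : exists H : {poly K}, H^`() = G.
Proof.
exists (\poly_(i < (size G).+1) (G`_i.-1 / i%:R)); apply/polyP => i.
rewrite coef_deriv coef_poly ltnS; case: ltnP => [_|leGi] /=.
  by rewrite -(mulr_natr (_ / _)) divfK // natr_neq0.
by rewrite mul0rn nth_default.
Qed.

(** Induction on the pole order: the derivative of [f] is some G(t), and [f] differs from H(t), with
    H' = G, by an element of zero derivative, that is, a constant. *)
Lemma stable_pullback k f : pole_le k f -> stable line_der regular f ->
  exists G, f = pullback_poly G.
Proof.
elim: k f => [|k IHk] f pf sf.
  by have [c ->] := pole_le0 pf; exists c%:P; rewrite pullback_polyC.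
have [||G fG] := IHk (line_der f).
- by apply: pole_le_der => //; exact: (sf 1%N).
- by move=> j; rewrite -iterSr; exact: sf.
have [H HG] := antiderivative_ex G.
have : line_der (f - pullback_poly H) = 0.
  by rewrite (derB line_derD) line_der_pullback HG fG subrr.
move/eqP; rewrite mulf_eq0 invr_eq0 (negPf D0t_neq0) orbF => /eqP.
move=> /(fraction_der_eq0 tau_eq0 den_neq0 num_den charK) [c fHc].
by exists (H + c%:P); rewrite rmorphD /= pullback_polyC -fHc addrC subrK.
Qed.

(** At T = t, Y = x the pencil of P vanishes and its Y-derivative is W/P2. The identity defining the
    discriminant becomes d(t) P2 = V(t, x) W, so d(t) cancels the W in the denominator of
    [line_der]. *)
Lemma pullback_discriminant_ex : exists d : {poly K},
  (forall f, regular f -> regular (pullback_poly d * line_der f)) /\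
  forall t0, separable_poly (P1 - t0 *: P2) -> d.[t0] != 0.
Proof.
have gt1 : (1 < size P1)%N.
  by apply: leq_ltn_trans ltP; rewrite size_poly_gt0.
have [d [U [V [bez sep]]]] := discriminant_ex charK ltP gt1.
exists d; split=> // f [k [u fE]].
pose ev (H : {poly {poly K}}) := (map_poly pullback_poly H).[tau 'X].
have evM G H : ev (G * H) = ev G * ev H by rewrite /ev rmorphM hornerM.
have evmap p : ev p^:P = tau p.
  rewrite /ev -map_poly_comp -{2}[p]comp_polyXr /comp_poly -horner_map.
  congr _.[_]; rewrite -map_poly_comp; apply: eq_map_poly => c /=.
  by rewrite pullback_polyC.
have evX : ev 'X%:P = t by rewrite /ev map_polyC hornerC /= pullback_polyX.
have evP : ev (pencil P1 P2) = 0.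
  rewrite /pencil -mul_polyC /ev rmorphB hornerD hornerN -!/(ev _) evM evX !evmap.
  by rewrite divfK // subrr.
have evP' : ev (pencil P1 P2)^`() * tau P2 = tau W.
  rewrite /pencil -mul_polyC derivB derivM derivC mul0r add0r /ev rmorphB.
  rewrite hornerD hornerN -!/(ev _) evM evX !deriv_map !evmap mulrBl mulrAC.
  by rewrite divfK // -!rmorphM -rmorphB.
have evV : regular (ev V).
  rewrite /ev horner_coef; apply: (subring_sum subring_regular) => i _.
  apply: (subringM subring_regular).
    by rewrite coef_map; exact: regular_pullback.
  by rewrite -rmorphXn; exact: regular_tau.
have dE : pullback_poly d * tau P2 = ev V * tau W.
  have : ev d%:P = pullback_poly d by rewrite /ev map_polyC hornerC.
  rewrite -bez /ev rmorphD hornerD -!/(ev _) !evM evP mulr0 add0r => <-.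
  by rewrite -mulrA evP'.
apply: (@regular_divX _ k.+1).
have -> : pullback_poly d * line_der f * tau P2 ^+ k.+1 =
  (pullback_poly d * tau P2) * (line_der f * tau P2 ^+ k) by rewrite exprS; ring.
have -> : pullback_poly d * tau P2 * (line_der f * tau P2 ^+ k) =
  ev V * (line_der f * tau W * tau P2 ^+ k) by rewrite dE; ring.
rewrite (line_derE fE); apply: (subringM subring_regular) => //.
by rewrite -rmorphM; exact: regular_tau.
Qed.

Variables Q1 Q2 : {poly K}.
Hypothesis ltQ : (size Q2 < size Q1)%N.
Hypothesis copQ : coprimep Q1 Q2.
Hypothesis Q2_neq0 : Q2 != 0.
Hypothesis Q1_gt1 : (1 < size Q1)%N.
Hypothesis sepPQ : forall t0, separable_poly (P1 - t0 *: P2) \/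
                              separable_poly (Q1 - t0 *: Q2).

(** The derivatives of the coefficients are regular once d(t) is inverted, by [stable_factor], and
    also once e(t) is inverted, by [der_localized]. Here [d] and [e] are the discriminants of Q and
    P; as they are coprime, the derivatives are regular, and [stable_pullback] applies. *)
Lemma factor_coefs_pullback (A B : {poly F}) : A \is monic ->
  A * B = map_poly pullback_poly (pencil Q1 Q2) -> coefs_in regular A ->
  forall i, exists G, A`_i = pullback_poly G.
Proof.
move=> Amon ABE regA i.
have [e [eder sepP]] := pullback_discriminant_ex.
have [d [U [V [bez sepQ]]]] := discriminant_ex charK ltQ Q1_gt1.
have d0 : d != 0.
  have [t0 /sepQ] := separable_pencil_ex charK Q2_neq0 copQ ltQ.
  by apply: contraNneq => ->; rewrite horner0.
have regd := regular_pullback d; have rege := regular_pullback e.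
have stab (O : F -> Prop) : (forall G, O (pullback_poly G)) ->
    forall G, stable line_der O (pullback_poly G).
  by move=> OG G j; elim: j G => // j IHj G; rewrite iterSr line_der_pullback.
have locG G : localized regular (pullback_poly d) (pullback_poly G).
  by apply: sub_localized; exact: regular_pullback.
have bezF : map_poly pullback_poly U * (A * B) +
    map_poly pullback_poly V * (A * B)^`() = (pullback_poly d)%:P.
  by rewrite ABE deriv_map -!rmorphM -rmorphD bez /= map_polyC.
have dF0 : pullback_poly d != 0 by rewrite pullback_poly_eq0.
have sd : coefs_in (stable line_der (localized regular (pullback_poly d))) A.
  apply: (stable_factor line_derD line_derM _ Amon bezF dF0).
  - exact: subring_localized subring_regular _ regd.
  - by exists 1%N; rewrite expr1 divff //; case: subring_regular.
  - by rewrite line_der_pullback; exact: stab.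
  - by move=> j; rewrite coef_map; exact: stab.
  - move=> j; rewrite coef_map_id0 ?(der0 line_derD) // ABE coef_map /=.
    by rewrite line_der_pullback; exact: stab.
  - by move=> j; exact: sub_localized.
have se : stable line_der (localized regular (pullback_poly e)) A`_i.
  elim=> [|j IHj] /=; first exact: sub_localized.
  apply: (der_localized line_derM subring_regular) => //.
  by rewrite line_der_pullback; exact: regular_pullback.
(* A common zero would be a value over which neither pencil is separable. *)
have copde : coprimep d e.
  apply: Pdiv.ClosedField.root_coprimep => z dz.
  have [/sepP //|/sepQ] := sepPQ z.
  by move/rootP: dz => ->; rewrite eqxx.
have sA : stable line_der regular A`_i.
  move=> j; have [[M dM] [N eN]] := (sd i j, se j).
  (* The two powers generate the unit ideal of K[T], so an element that each of them makes regular
     is itself regular. *)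
  have /Bezout_eq1_coprimepP [[u v] /= uvE] : coprimep (d ^+ M) (e ^+ N).
    exact: coprimep_expl (coprimep_expr _ _).
  set f := iter j line_der A`_i in dM eN *.
  have -> : f = pullback_poly u * (pullback_poly d ^+ M * f) +
      pullback_poly v * (pullback_poly e ^+ N * f).
    rewrite !mulrA -!rmorphXn -!rmorphM /= -mulrDl -rmorphD uvE.
    by rewrite rmorph1 mul1r.
  apply: (subringD subring_regular); apply: (subringM subring_regular) => //;
    exact: regular_pullback.
have [k pk] := regular_pole_le (regA i).
exact: stable_pullback pk sA.
Qed.

End RegularFunctions.

(** * Irreducibility for pairs with a pole at infinity *)

Section Curve.
Variable K : closedFieldType.
Implicit Types (p q : {poly K}) (H : {poly {poly K}}).

Definition curve p1 p2 q1 q2 : {poly {poly K}} :=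
  p1^:P * q2%:P - p2^:P * q1%:P.

Lemma size1_unit p : size p = 1%N -> p \is a GRing.unit.
Proof.
move=> sz1; rewrite poly_unitE sz1 eqxx unitfE /=; apply/eqP => p0.
by move: (sz1); rewrite (size1_polyC (eq_leq sz1)) p0 size_poly0.
Qed.

Lemma coprimep_lin_indep p1 p2 (a b : K) :
  coprimep p1 p2 -> (1 < maxn (size p1) (size p2))%N -> a *: p1 = b *: p2 ->
  a = 0 /\ b = 0.
Proof.
move=> cop gt1 e; have [a0|a0] := eqVneq a 0.
  split=> //; apply/eqP; apply: contraTT gt1 => b0.
  have p20 : p2 = 0.
    by move/esym/eqP: e; rewrite a0 scale0r scaler_eq0 (negPf b0) => /eqP.
  by move: cop; rewrite p20 coprimep0 size_poly0 maxn0 -size_poly_eq1 => /eqP ->.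
have p1E : p1 = (b / a) *: p2.
  by apply: (scalerI a0); rewrite e scalerA mulrC divfK.
have sz2 : size p2 = 1%N.
  have d21 : p2 %| p1 by rewrite p1E -mul_polyC dvdp_mull.
  by rewrite -(eqp_size (dvdp_gcd_idr d21)); apply/eqP.
have : (size p1 <= 1)%N by rewrite p1E -sz2 size_scale_leq.
by move: gt1; rewrite sz2 leq_max ltnn orbF ltnNge => /negPf ->.
Qed.

(** At a root z of [a], the relation q2(z) p1 = q1(z) p2 forces q1(z) = q2(z) = 0, against
    coprimality. *)
Lemma curve_cst_factor p1 p2 q1 q2 (a : {poly K}) H :
  coprimep p1 p2 -> coprimep q1 q2 -> (1 < maxn (size p1) (size p2))%N ->
  curve p1 p2 q1 q2 = a%:P * H -> a \is a GRing.unit.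
Proof.
move=> copp copq gt1 cE; apply: size1_unit; apply/eqP/negPn/negP => /closed_rootP [z az].
have := congr1 (map_poly (horner_eval z)) cE.
rewrite rmorphM /= [map_poly _ a%:P]map_polyC /= {2}/horner_eval (rootP az) mul0r.
rewrite rmorphB !rmorphM /= !map_polyC -!map_poly_comp /=.
have hC (r : {poly K}) : map_poly (horner_eval z \o polyC) r = r.
  by rewrite map_poly_id // => c _ /=; rewrite /horner_eval hornerC.
rewrite !hC /horner_eval ![_ * _%:P]mulrC !mul_polyC => /eqP.
rewrite subr_eq0 => /eqP e.
have [q2z q1z] := coprimep_lin_indep copp gt1 e.
have := coprimep_root copq (_ : root q1 z); rewrite q2z eqxx rootE q1z.
by move/(_ (eqxx _)).
Qed.

Lemma coef_curve p1 p2 q1 q2 i :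
  (curve p1 p2 q1 q2)`_i = p1`_i *: q2 - p2`_i *: q1.
Proof. by rewrite coefB !coefMC !coef_map /= !mul_polyC. Qed.

Lemma size_curve p1 p2 q2 : q2 != 0 -> forall q1, (size p2 < size p1)%N ->
  size (curve p1 p2 q1 q2) = size p1.
Proof.
move=> q20 q1 lt; have p1_gt0 : (0 < size p1)%N by exact: leq_ltn_trans lt.
apply/eqP; rewrite eqn_leq; apply/andP; split.
  apply/leq_sizeP => j lej; rewrite coef_curve !nth_default ?scale0r ?subrr //.
  by apply: leq_trans lej; exact: ltnW.
rewrite leqNgt; apply/negP => lts.
have : (curve p1 p2 q1 q2)`_(size p1).-1 = 0.
  by rewrite nth_default // -ltnS prednK.
rewrite coef_curve [p2`_ _]nth_default ?scale0r ?subr0; last by rewrite -ltnS prednK.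
move/eqP; rewrite scaler_eq0 (negPf q20) orbF -lead_coefE lead_coef_eq0.
by rewrite -size_poly_eq0 -leqn0 leqNgt p1_gt0.
Qed.

Lemma lead_coef_curve p1 p2 q2 : q2 != 0 -> forall q1, (size p2 < size p1)%N ->
  lead_coef (curve p1 p2 q1 q2) = lead_coef p1 *: q2.
Proof.
move=> q20 q1 lt; have p1_gt0 : (0 < size p1)%N by exact: leq_ltn_trans lt.
rewrite lead_coefE size_curve // coef_curve [p2`_ _]nth_default ?scale0r ?subr0 //.
by rewrite -ltnS prednK.
Qed.

Lemma map_coefs_ex (A : nzRingType) (B : nzRingType) (f : {rmorphism A -> B})
    (p : {poly B}) : (forall a, (f a == 0) = (a == 0)) ->
  (forall i, exists a, p`_i = f a) -> exists q : {poly A}, p = map_poly f q.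
Proof.
move=> f0 pf; have [g gE] := fin_all_exists (fun i : 'I_(size p) => pf i).
exists (\poly_(i < size p) if insub i is Some j then g j else 0).
apply/polyP => i; rewrite coef_map coef_poly; case: ltnP => [lti|lei].
  by rewrite insubT /= -gE.
by rewrite nth_default //; apply/esym/eqP; rewrite f0.
Qed.

(** Only degrees in the outer variable have to be examined: a factor of degree 0 there is a unit by
    [curve_cst_factor]. *)
Lemma irreducible_curve p1 p2 q1 q2 :
  q2 != 0 -> coprimep p1 p2 -> coprimep q1 q2 ->
  (size p2 < size p1)%N -> (1 < size p1)%N ->
  (forall A B, curve p1 p2 q1 q2 = A * B -> size A = 1%N \/ size B = 1%N) ->
  irreducible_elt (curve p1 p2 q1 q2).
Proof.
move=> q20 copp copq lt gt1 fact; have szc := size_curve q20 q1 lt.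
split.
- by rewrite -size_poly_gt0 szc (ltn_trans _ gt1).
- by rewrite poly_unitE szc gtn_eqF.
move=> A B cE.
have unit_factor (G H : {poly {poly K}}) : curve p1 p2 q1 q2 = G * H ->
    size G = 1%N -> G \is a GRing.unit.
  move=> GH szG; have GC : G = (G`_0)%:P by apply: size1_polyC; rewrite szG.
  rewrite poly_unitE szG eqxx /=; rewrite GC in GH.
  by apply: curve_cst_factor GH => //; rewrite leq_max gt1.
have [szA|szB] := fact A B cE.
- by left; exact: unit_factor cE szA.
- by right; apply: (unit_factor B A) => //; rewrite mulrC.
Qed.

(** With T made the outer variable, the pencil has degree 1, so one factor does not involve T; that
    factor divides both p1 and p2 and is constant. *)
Lemma pencil_factor p1 p2 (A C : {poly {poly K}}) :
  p2 != 0 -> coprimep p1 p2 -> pencil p1 p2 = C * A ->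
  size C = 1%N \/ size A = 1%N.
Proof.
move=> p20 cop pE.
have sE : swapXY C * swapXY A = p1%:P - 'X * p2%:P.
  rewrite -rmorphM /= -pE /pencil -mul_polyC rmorphB rmorphM /=.
  by rewrite !swapXY_map_polyC swapXY_polyC map_polyX.
have sz2 : size (p1%:P - 'X * p2%:P) = 2.
  rewrite mulrC -opprB size_polyN -[_ - _]/(p2%:P * 'X + - p1%:P) -polyCN.
  by rewrite size_MXaddC polyC_eq0 (negPf p20) /= size_polyC p20.
have cst (G H : {poly {poly K}}) : swapXY G * swapXY H = p1%:P - 'X * p2%:P ->
    (size (swapXY G) <= 1)%N -> size G = 1%N.
  move=> GH /size1_polyC GE; set c := (swapXY G)`_0 in GE.
  have cD i : c %| (p1%:P - 'X * p2%:P)`_i.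
    by rewrite -GH GE coefCM dvdp_mulr.
  have c1 : c %| p1 by have := cD 0%N; rewrite coefB coefC coefXM subr0.
  have c2 : c %| p2.
    by have := cD 1%N; rewrite coefB coefC coefXM coefC sub0r dvdpNr.
  have szc : size c = 1%N.
    apply/eqP; rewrite -dvdp1; move: cop; rewrite /coprimep size_poly_eq1.
    by move/(eqp_dvdr c) <-; rewrite dvdp_gcd c1.
  have [k k0 ck] : exists2 k, k != 0 & c = k%:P.
    have cc : c = (c`_0)%:P by apply: size1_polyC; rewrite szc.
    exists c`_0 => //; apply/eqP => c0.
    by move: szc; rewrite cc c0 size_poly0.
  by rewrite -[G]swapXYK GE swapXY_polyC ck map_polyC size_polyC polyC_eq0 k0.
have [lt1|gt1] := leqP (size (swapXY C)) 1; first by left; exact: cst sE lt1.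
right; apply: (cst A C); first by rewrite mulrC.
have [C0 A0] : swapXY C != 0 /\ swapXY A != 0.
  by apply/andP; rewrite -negb_or -mulf_eq0 sE -size_poly_eq0 sz2.
have := size_mul C0 A0; rewrite sE sz2; move: gt1.
by move: (size _) (size _) => a b; lia.
Qed.

End Curve.

(** * Factors of the curve when P and Q both have a pole at infinity *)

Section NormalizedCurve.
Variables (K : closedFieldType) (F : fieldType) (tau : {rmorphism {poly K} -> F}).
Variables (num den : F -> {poly K}).
Hypothesis charK : [pchar K] =i pred0.
Hypothesis tau_eq0 : forall p, (tau p == 0) = (p == 0).
Hypothesis den_neq0 : forall f, den f != 0.
Hypothesis num_den : forall f, f * tau (den f) = tau (num f).
Variables (P1 P2 Q1 Q2 : {poly K}).
Hypotheses (P2_neq0 : P2 != 0) (Q2_neq0 : Q2 != 0).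
Hypotheses (copP : coprimep P1 P2) (copQ : coprimep Q1 Q2).
Hypotheses (ltP : (size P2 < size P1)%N) (ltQ : (size Q2 < size Q1)%N).
Hypothesis sepPQ : forall t0, separable_poly (P1 - t0 *: P2) \/
                              separable_poly (Q1 - t0 *: Q2).

Let Q1_gt1 : (1 < size Q1)%N.
Proof. by apply: leq_ltn_trans ltQ; rewrite size_poly_gt0. Qed.

Local Notation phi := (pullback_poly tau P1 P2).

Lemma map_curve : map_poly tau (curve Q1 Q2 P1 P2) =
  tau P2 *: map_poly phi (pencil Q1 Q2).
Proof.
have tauP2 : tau P2 != 0 by rewrite tau_eq0.
have -> : pencil Q1 Q2 = Q1^:P - 'X%:P * Q2^:P by rewrite mul_polyC.
rewrite /curve -mul_polyC !rmorphB !rmorphM /=.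
rewrite !map_polyC /= pullback_polyX -!map_poly_comp mulrBr mulrC; congr (_ - _).
  congr (_ * _); apply: eq_map_poly => c /=; by rewrite pullback_polyC.
rewrite mulrA -polyCM mulrC [tau P2 * _]mulrC divfK //; congr (_ * _).
by apply: eq_map_poly => c /=; rewrite pullback_polyC.
Qed.

(** Made monic over [F], the factor [A0] has coefficients in K[t] by [factor_coefs_pullback]; it
    thus comes from a factor [A1] of the pencil over K[T], to which [pencil_factor] applies. *)
Lemma normalized_curve_factor (A0 B0 : {poly {poly K}}) :
  curve Q1 Q2 P1 P2 = A0 * B0 -> size A0 = 1%N \/ size B0 = 1%N.
Proof.
move=> cE; have tauP2 : tau P2 != 0 by rewrite tau_eq0.
have phi0 G : (phi G == 0) = (G == 0) by exact: pullback_poly_eq0.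
have szc := size_curve P2_neq0 P1 ltQ.
have lcc := lead_coef_curve P2_neq0 P1 ltQ.
have c0 : curve Q1 Q2 P1 P2 != 0 by rewrite -size_poly_gt0 szc (ltn_trans _ Q1_gt1).
have [A00 B00] : A0 != 0 /\ B0 != 0.
  by apply/andP; rewrite -negb_or -mulf_eq0 -cE.
pose a := tau (lead_coef A0).
have a0 : a != 0 by rewrite tau_eq0 lead_coef_eq0.
pose A := a^-1 *: map_poly tau A0; pose B := (a / tau P2) *: map_poly tau B0.
have szA : size A = size A0.
  by rewrite size_scale ?invr_eq0 // size_map_poly_id0 // tau_eq0 lead_coef_eq0.
have Amon : A \is monic.
  apply/monicP; rewrite lead_coefZ lead_coef_map_eq ?mulVf //.
have ABE : A * B = map_poly phi (pencil Q1 Q2).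
  rewrite -scalerAl -scalerAr scalerA mulrA mulVf // mul1r -rmorphM -cE.
  by rewrite /= map_curve scalerA mulVf // scale1r.
have regA : coefs_in (regular tau P2) A.
  move=> i; exists 1%N, ((lead_coef Q1)^-1 *: (A0`_i * lead_coef B0)).
  rewrite expr1 coefZ coef_map.
  have q0 : lead_coef Q1 != 0 by rewrite lead_coef_eq0 -size_poly_gt0 (ltn_trans _ Q1_gt1).
  (* The leading coefficients of [A0] and [B0] multiply to a constant times P2, so dividing by that
     of [A0] introduces only P2 as a denominator. *)
  have P2E : P2 = (lead_coef Q1)^-1 *: (lead_coef A0 * lead_coef B0).
    by rewrite -lead_coefM -cE lcc scalerA mulVf // scale1r.
  rewrite [in LHS]P2E -!mul_polyC !rmorphM /= -/a.
  rewrite -[RHS]mul1r -(mulVf a0); ring.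
have coA := factor_coefs_pullback charK tau_eq0 den_neq0 num_den P2_neq0 copP
  ltP ltQ copQ Q2_neq0 Q1_gt1 sepPQ Amon ABE regA.
have [A1 AE] := map_coefs_ex phi0 coA.
have phi_inj : injective phi.
  by move=> G H GH; apply/eqP; rewrite -subr_eq0 -phi0 rmorphB /= GH subrr.
have szA1 : size A1 = size A.
  by rewrite AE (size_map_inj_poly phi_inj (rmorph0 _)).
have A1mon : A1 \is monic.
  apply/monicP/phi_inj; rewrite rmorph1 -(monicP Amon) AE lead_coef_map_inj //.
  exact: rmorph0.
have divE := Pdiv.RingMonic.rdivp_eq A1mon (pencil Q1 Q2).
have ltR := Pdiv.Ring.ltn_rmodpN0 (pencil Q1 Q2) (monic_neq0 A1mon).
move: divE ltR; set C := Pdiv.Ring.rdivp _ _; set R := Pdiv.Ring.rmodp _ _ => divE ltR.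
(* Over [F] the remainder is a multiple of [A] of smaller degree; since [phi] is injective, it
   already vanishes over K[T]. *)
have R0 : R = 0.
  have RE : map_poly phi R = (B - map_poly phi C) * (A : {poly F}).
    have := congr1 (map_poly phi) divE; rewrite -ABE rmorphD rmorphM /= -AE.
    by rewrite mulrBl [B * _]mulrC => ->; rewrite addrAC subrr add0r.
  apply/eqP; rewrite -size_poly_eq0 -(size_map_inj_poly phi_inj (rmorph0 _)).
  rewrite size_poly_eq0; apply/negPn/negP => R0.
  have dAR : (A : {poly F}) %| map_poly phi R by rewrite RE dvdp_mulIr.
  have := dvdp_leq R0 dAR; rewrite leqNgt.
  by rewrite (size_map_inj_poly phi_inj (rmorph0 _)) -szA1 ltR.
rewrite R0 addr0 in divE.
have [szC|] := pencil_factor Q2_neq0 copQ divE; last by rewrite szA1 szA; left.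
right; have szq : size (pencil Q1 Q2) = size Q1.
  rewrite -szc -[in RHS](size_map_inj_poly (tau_inj tau_eq0) (rmorph0 tau)).
  by rewrite map_curve size_scale // (size_map_inj_poly phi_inj (rmorph0 _)).
have C0 : C != 0 by rewrite -size_poly_eq0 szC.
have A1gt0 : (0 < size A1)%N by rewrite size_poly_gt0 monic_neq0.
move: szc; rewrite cE size_mul // -szA -szA1 -szq {1}divE size_Mmonic // szC.
by move: A1gt0; move: (size A1) (size B0) => b c; lia.
Qed.

End NormalizedCurve.

Theorem normalized_curve_irreducible (K : closedFieldType) (P1 P2 Q1 Q2 : {poly K}) :
  [pchar K] =i pred0 -> P2 != 0 -> Q2 != 0 -> coprimep P1 P2 -> coprimep Q1 Q2 ->
  (size P2 < size P1)%N -> (size Q2 < size Q1)%N ->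
  (forall t0, separable_poly (P1 - t0 *: P2) \/ separable_poly (Q1 - t0 *: Q2)) ->
  irreducible_elt (curve Q1 Q2 P1 P2).
Proof.
move=> charK P20 Q20 copP copQ ltP ltQ sep.
have Q1_gt1 : (1 < size Q1)%N by apply: leq_ltn_trans ltQ; rewrite size_poly_gt0.
apply: irreducible_curve => // A B cE.
have den0 (f : {fraction {poly K}}) : \d_(repr f) != 0 by exact: denom_ratioP.
have := normalized_curve_factor charK (@tofrac_eq0 _) den0
  (@fraction_denom _) P20 Q20 copP copQ ltP ltQ sep cE.
exact.
Qed.

(** * Changes of coordinates *)

Lemma irreducible_rmorph (A B : idomainType) (f : {rmorphism A -> B}) (p : A) :
  (forall x, f x \is a GRing.unit -> x \is a GRing.unit) ->
  irreducible_elt (f p) -> irreducible_elt p.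
Proof.
move=> fU [fp0 fpNU fpI]; split.
- by apply: contraNneq fp0 => ->; rewrite rmorph0.
- by apply: contra fpNU; exact: rmorph_unit.
- by move=> q r pE; case: (fpI (f q) (f r)) => [|/fU|/fU];
    [rewrite pE rmorphM | left | right].
Qed.

Lemma irreducible_opp (A : idomainType) (p : A) :
  irreducible_elt (- p) -> irreducible_elt p.
Proof.
move=> [p0 pNU pI]; split; [by rewrite -oppr_eq0 | by rewrite -unitrN | move=> q r pE].
have /pI [] : - p = - q * r by rewrite pE mulNr.
  by rewrite unitrN; left.
by right.
Qed.

(** * The substitution of 1/w for the variable *)

Section Reversal.
Variable A : idomainType.
Implicit Types p q : {poly A}.

(** This is w^n p(1/w) when deg p is at most [n]; [n] is kept explicit because p may have smaller
    degree. *)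
Definition reversal n p : {poly A} := \poly_(i < n.+1) p`_(n - i).

Lemma coef_reversal n p i : (i <= n)%N -> (reversal n p)`_i = p`_(n - i).
Proof. by move=> lein; rewrite coef_poly ltnS lein. Qed.

Lemma reversalE n p :
  reversal n p = \sum_(i < n.+1) p`_i *: 'X^(n - i).
Proof.
rewrite /reversal poly_def (reindex_inj rev_ord_inj) /=.
by apply: eq_bigr => i _; rewrite subSS subKn // -ltnS.
Qed.

Lemma reversalD n p q : reversal n (p + q) = reversal n p + reversal n q.
Proof.
apply/polyP => i; rewrite coefD !coef_poly coefD.
by case: ifP; rewrite ?addr0.
Qed.

Lemma reversalZ n a p : reversal n (a *: p) = a *: reversal n p.
Proof.
apply/polyP => i; rewrite coefZ !coef_poly coefZ.
by case: ifP; rewrite ?mulr0.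
Qed.

Lemma reversal_sum n k (f : 'I_k -> {poly A}) :
  reversal n (\sum_(i < k) f i) = \sum_(i < k) reversal n (f i).
Proof.
apply: (big_morph _ (reversalD n)).
by apply/polyP => i; rewrite coef_poly !coef0 if_same.
Qed.

Lemma reversalXn n k : (k <= n)%N -> reversal n 'X^k = 'X^(n - k).
Proof.
move=> lekn; apply/polyP => i; rewrite coef_poly !coefXn.
case: ifP => [|/negbT]; rewrite ltnS; first by move=> ?; congr (_%:R); lia.
by rewrite -ltnNge => lt; case: eqP => //; lia.
Qed.

Lemma reversalM a b p q : (size p <= a.+1)%N -> (size q <= b.+1)%N ->
  reversal (a + b) (p * q) = reversal a p * reversal b q.
Proof.
have expand n (r : {poly A}) : (size r <= n.+1)%N -> r = \sum_(i < n.+1) r`_i *: 'X^i.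
  move=> ler; apply: etrans (poly_def n.+1 (fun i => r`_i)).
  apply/polyP => i; rewrite coef_poly.
  by case: ltnP => // le; rewrite nth_default // (leq_trans ler).
move=> /expand pE /expand qE; rewrite {1}pE {1}qE !reversalE mulr_suml.
rewrite -reversalE reversal_sum mulr_suml; apply: eq_bigr => i _.
rewrite mulr_sumr reversal_sum mulr_sumr; apply: eq_bigr => j _.
rewrite -!scalerAl -!scalerAr !reversalZ -!exprD reversalXn; last first.
  by have := ltn_ord i; have := ltn_ord j; lia.
do 2!congr (_ *: _); congr ('X^_).
by have := ltn_ord i; have := ltn_ord j; lia.
Qed.

(** Every factor of [p] also has a nonzero constant term, so reversing it keeps its degree; a factor
    whose reversal is a unit is then constant. *)
Lemma irreducible_reversal p : p`_0 != 0 ->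
  irreducible_elt (reversal (size p).-1 p) -> irreducible_elt p.
Proof.
have unitR (r : {poly A}) : r`_0 != 0 -> reversal (size r).-1 r \is a GRing.unit ->
    r \is a GRing.unit.
  move=> r0 ru; have szr : (size r).-1 = 0%N.
    move: ru; rewrite poly_unitE => /andP[/eqP sz1 _].
    have : (reversal (size r).-1 r)`_(size r).-1 != 0.
      by rewrite coef_reversal // subnn.
    by apply: contraNeq; case: ((size r).-1) sz1 => // k sz1 _;
      rewrite nth_default // sz1.
  have rC : r = (r`_0)%:P by apply: size1_polyC; move: szr; case: (size r) => [|[]].
  move: ru; rewrite szr /reversal poly_def big_ord1 subn0 expr0 -[r in X in X -> _]/r.
  by rewrite alg_polyC -rC.
move=> p0 [pr0 prNU prI]; have nz : p != 0.
  by apply: contraNneq p0 => ->; rewrite coef0.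
split=> //.
  apply: contra prNU => pu; move: (pu); rewrite poly_unitE => /andP[/eqP sz1 _].
  have -> // : reversal (size p).-1 p = p.
  rewrite sz1 /reversal poly_def big_ord1 subn0 expr0 alg_polyC -size1_polyC //.
  by rewrite sz1.
move=> q r pE; have [q0 r0] : q`_0 != 0 /\ r`_0 != 0.
  by apply/andP; rewrite -negb_or -mulf_eq0 -coef0M -pE.
have [qn rn] : q != 0 /\ r != 0 by apply/andP; rewrite -negb_or -mulf_eq0 -pE.
have [q1 r1] : (0 < size q)%N /\ (0 < size r)%N by rewrite !size_poly_gt0.
have [|/unitR qu|/unitR ru] := prI (reversal (size q).-1 q) (reversal (size r).-1 r).
- rewrite -reversalM ?prednK // -pE; congr (reversal _ _).
  rewrite pE size_mul //; move: q1 r1; move: (size q) (size r) => a b; lia.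
- by left; apply: qu.
- by right; apply: ru.
Qed.

End Reversal.

(** * Binary forms and their roots on the projective line *)

Section ProjectiveRoots.
Variable K : closedFieldType.
Implicit Types (p q : {poly K}) (z : option K).

(* [p] is seen as a binary form of degree [n]. *)
Definition proj_root n p z : bool :=
  if z is Some x then root p x else p`_n == 0.

(** For a nonzero form of degree [n] this is squarefreeness, stated through points so that it can be
    transported along changes of coordinate. *)
Definition many_proj_roots n p :=
  exists s : seq (option K), [/\ uniq s, (n <= size s)%N & all (proj_root n p) s].

Lemma many_proj_roots_map n p q (h : option K -> option K) : injective h ->
  (forall z, proj_root n p z -> proj_root n q (h z)) ->
  many_proj_roots n p -> many_proj_roots n q.
Proof.
move=> hI hpq [s [us les sp]]; exists (map h s).
rewrite map_inj_uniq // size_map; split=> //.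
by apply/allP => _ /mapP[z zs ->]; apply: hpq; exact: (allP sp).
Qed.

(** Exact degree [n] excludes the root at infinity, so the [n] distinct finite roots exhaust the
    polynomial. *)
Lemma separable_many_proj_roots n p : size p = n.+1 -> many_proj_roots n p ->
  separable_poly p.
Proof.
move=> szp [s [us les sp]].
have p0 : p != 0 by rewrite -size_poly_eq0 szp.
have sE : s = map Some (pmap id s).
  elim: s sp {us les} => //= -[x|] s IHs /= /andP[pz sp]; first by rewrite -IHs.
  by move: pz; have := lead_coef_eq0 p; rewrite lead_coefE szp (negPf p0) => ->.
set r := pmap id s in sE.
have rp : all (root p) r by move: sp; rewrite sE all_map.
have ur : uniq r by move: us; rewrite sE map_inj_uniq // => x y [].
have szr : size p = (size r).+1.
  apply/eqP; rewrite eqn_leq (max_poly_roots p0 rp ur) andbT szp ltnS.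
  by rewrite sE size_map in les.
rewrite (all_roots_prod_XsubC szr rp) ?uniq_rootsE //.
rewrite (eqp_separable (eqp_scale _ _)) ?lead_coef_eq0 //.
by rewrite separable_prod_XsubC.
Qed.

Definition proj_shift (c : K) z : option K := omap (fun x => x - c) z.

Lemma proj_shift_inj c : injective (proj_shift c).
Proof. by move=> [x|] [y|] //= [/addIr ->]. Qed.

Lemma coef_comp_XaddC p (c : K) n : (size p <= n.+1)%N ->
  (p \Po ('X + c%:P))`_n = p`_n.
Proof.
rewrite leq_eqVlt => /orP[/eqP szp|ltp]; last first.
  by rewrite !nth_default // size_comp_poly2 // size_XaddC.
have sz2 : size (p \Po ('X + c%:P)) = n.+1 by rewrite size_comp_poly2 ?size_XaddC.
have := lead_coef_comp p (_ : (1 < size ('X + c%:P)%R)%N).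
rewrite size_XaddC => /(_ isT); rewrite !lead_coefE sz2 szp => ->.
by rewrite -lead_coefE lead_coefXaddC expr1n mulr1.
Qed.

Lemma proj_root_shift n p c z : (size p <= n.+1)%N ->
  proj_root n p z -> proj_root n (p \Po ('X + c%:P)) (proj_shift c z).
Proof.
move=> szp; case: z => [x|] /=; last by rewrite coef_comp_XaddC.
by rewrite !rootE horner_comp !hornerE subrK.
Qed.

Definition proj_inv z : option K :=
  if z is Some x then (if x == 0 then None else Some x^-1) else Some 0.

Lemma proj_inv_inj : injective proj_inv.
Proof.
apply: (can_inj (g := proj_inv)) => -[x|] /=; last by rewrite eqxx.
by case: (eqVneq x 0) => [->|x0] //=; rewrite invr_eq0 (negPf x0) invrK.
Qed.

Lemma horner_reversal n p x : (size p <= n.+1)%N -> x != 0 ->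
  (reversal n p).[x] = x ^+ n * p.[x^-1].
Proof.
move=> szp x0; rewrite reversalE horner_sum (horner_coef_wide _ szp) mulr_sumr.
apply: eq_bigr => i _; have lein : (i <= n)%N by rewrite -ltnS.
rewrite hornerZ hornerXn mulrCA exprVn.
have -> : x ^+ n = x ^+ (n - i) * x ^+ i by rewrite -exprD subnK.
by rewrite mulfK // expf_neq0.
Qed.

Lemma proj_root_reversal n p z : (size p <= n.+1)%N ->
  proj_root n p z -> proj_root n (reversal n p) (proj_inv z).
Proof.
move=> szp; case: z => [x|] /=; last first.
  by rewrite rootE horner_coef0 coef_reversal // subn0.
case: eqVneq => [->|x0] /=; first by rewrite rootE horner_coef0 coef_reversal // subnn.
by rewrite !rootE horner_reversal ?invr_eq0 // invrK => /eqP ->; rewrite mulr0.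
Qed.

Lemma reversalB n p q : reversal n (p - q) = reversal n p - reversal n q.
Proof. by rewrite -scaleN1r reversalD reversalZ scaleN1r. Qed.

Lemma coprimep_reversal p q : coprimep p q -> (size q <= size p)%N ->
  p != 0 -> coprimep (reversal (size p).-1 p) (reversal (size p).-1 q).
Proof.
move=> cop leqp p0; apply: Pdiv.ClosedField.root_coprimep => x.
have p1 : (0 < size p)%N by rewrite size_poly_gt0.
have [->|x0] := eqVneq x 0.
  by rewrite rootE horner_coef0 coef_reversal // subn0 -lead_coefE lead_coef_eq0 (negPf p0).
rewrite rootE !horner_reversal ?prednK // !mulf_eq0 expf_eq0 (negPf x0) andbF /=.
by move/(coprimep_root cop).
Qed.

End ProjectiveRoots.

(** * Moving a pole to infinity *)

Section Normalization.
Variable K : closedFieldType.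
Hypothesis charK : [pchar K] =i pred0.
Implicit Types (p q : {poly K}).

Lemma curve_shift (c : K) p1 p2 q1 q2 :
  comp_poly ('X + c%:P%:P) (curve p1 p2 q1 q2) =
  curve (p1 \Po ('X + c%:P)) (p2 \Po ('X + c%:P)) q1 q2.
Proof.
have XcP : (('X + c%:P) : {poly K})^:P = 'X + c%:P%:P.
  by rewrite rmorphD /= map_polyX map_polyC.
by rewrite /curve rmorphB !rmorphM /= !map_comp_poly /= XcP !comp_polyC.
Qed.

Lemma curve_reversal n p1 p2 q1 q2 :
  reversal n (curve p1 p2 q1 q2) = curve (reversal n p1) (reversal n p2) q1 q2.
Proof.
apply/polyP => i; rewrite coef_curve !coef_poly coef_curve.
by case: ifP; rewrite ?scale0r ?subrr.
Qed.

Lemma irreducible_shift (c : K) p1 p2 q1 q2 :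
  irreducible_elt (curve (p1 \Po ('X + c%:P)) (p2 \Po ('X + c%:P)) q1 q2) ->
  irreducible_elt (curve p1 p2 q1 q2).
Proof.
rewrite -curve_shift; apply: irreducible_rmorph => H HU.
rewrite -[H]comp_polyXr (_ : 'X = ('X + c%:P%:P) \Po ('X - c%:P%:P)).
  by rewrite comp_polyA; exact: rmorph_unit.
by rewrite comp_polyD comp_polyX comp_polyC subrK.
Qed.

Lemma irreducible_curve_swap p1 p2 q1 q2 :
  irreducible_elt (curve q1 q2 p1 p2) -> irreducible_elt (curve p1 p2 q1 q2).
Proof.
have -> : curve q1 q2 p1 p2 = swapXY (- curve p1 p2 q1 q2).
  rewrite /curve opprB rmorphB !rmorphM /= !swapXY_polyC !swapXY_map_polyC.
  by rewrite [_%:P * _]mulrC [p1%:P * _]mulrC.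
move=> irr; apply: irreducible_opp.
pose f : {rmorphism {poly {poly K}} -> {poly {poly K}}} := @swapXY K.
pose AA : idomainType := {poly {poly K}}.
have h := @irreducible_rmorph AA AA f (- curve p1 p2 q1 q2).
apply: h => // H HU.
by rewrite -[H]swapXYK; exact: (rmorph_unit f HU).
Qed.

(** If infinity is not already a pole, a root of p2 is translated to 0 and then sent to infinity by
    inversion. Both moves preserve the number of distinct projective roots and reflect
    irreducibility of the curve. *)
Lemma normalize_pole p1 p2 : p2 != 0 -> coprimep p1 p2 ->
  (1 < maxn (size p1) (size p2))%N ->
  exists p1' p2', [/\ p2' != 0, coprimep p1' p2',
    (size p2' < size p1')%N /\ size p1' = maxn (size p1) (size p2),
    forall t0, many_proj_roots (maxn (size p1) (size p2)).-1 (p1 - t0 *: p2) ->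
      separable_poly (p1' - t0 *: p2') &
    forall q1 q2, q2 != 0 -> coprimep q1 q2 -> (1 < maxn (size q1) (size q2))%N ->
      irreducible_elt (curve p1' p2' q1 q2) -> irreducible_elt (curve p1 p2 q1 q2)].
Proof.
move=> p20 cop gt1.
have sz_sub n (r1 r2 : {poly K}) t0 : size r1 = n -> (size r2 < n)%N ->
    size (r1 - t0 *: r2) = n.
  move=> sz1 lt2; rewrite size_polyDl ?sz1 // size_polyN.
  exact: leq_ltn_trans (size_scale_leq _ _) lt2.
have [lt21|le12] := ltnP (size p2) (size p1).
  exists p1, p2; split=> // t0.
  apply: separable_many_proj_roots; rewrite prednK ?(leq_ltn_trans _ lt21) //.
  exact: sz_sub.
rewrite (maxn_idPr le12) in gt1; set n := (size p2).-1.
have szp2 : size p2 = n.+1 by rewrite /n prednK // (ltn_trans _ gt1).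
have /closed_rootP [c p2c] : size p2 != 1%N by rewrite gtn_eqF.
pose r1 := p1 \Po ('X + c%:P); pose r2 := p2 \Po ('X + c%:P).
have sz1 : size r1 = size p1 by rewrite size_comp_poly2 ?size_XaddC.
have sz2 : size r2 = n.+1 by rewrite size_comp_poly2 ?size_XaddC.
have r20 : r2`_0 = 0 by rewrite -horner_coef0 horner_comp !hornerE; exact/rootP.
have r10 : r1`_0 != 0.
  rewrite -horner_coef0 horner_comp !hornerE.
  by rewrite coprimep_sym in cop; exact: coprimep_root cop p2c.
have r2_neq0 : r2 != 0 by rewrite -size_poly_eq0 sz2.
have lc2 : r2`_n != 0 by rewrite -[n]/(n.+1.-1) -sz2 -lead_coefE lead_coef_eq0.
have copr : coprimep r1 r2 by rewrite coprimep_comp_poly.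
(* [r1] may have degree below [n], but its nonzero constant term gives the reversal full degree,
   whereas the zero of [r2] at 0 lowers the degree of its reversal. *)
have szr1 : size (reversal n r1) = n.+1.
  apply/eqP; rewrite eqn_leq size_poly /= ltnNge; apply/negP => /leq_sizeP/(_ n (leqnn _)).
  by rewrite coef_reversal // subnn; apply/eqP.
have szr2 : (size (reversal n r2) <= n)%N.
  apply/leq_sizeP => j lej; have [lejn|ltnj] := leqP j n; last first.
    by rewrite coef_poly ltnS leqNgt ltnj.
  by rewrite coef_reversal // (_ : (n - j)%N = 0%N) //; apply/eqP; rewrite subn_eq0.
exists (reversal n r1), (reversal n r2); split.
- apply: contraNneq lc2 => r2'0; have := coef_reversal r2 (leq0n n).
  by rewrite subn0 r2'0 coef0 => <-.
- have cop21 : coprimep r2 r1 by rewrite coprimep_sym.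
  have := coprimep_reversal cop21; rewrite sz2 /= sz1 -szp2 coprimep_sym.
  exact.
- by rewrite szr1 ltnS -szp2.
- move=> t0 many; rewrite -reversalZ -reversalB.
  apply: (@separable_many_proj_roots _ n).
    by rewrite reversalB reversalZ; apply: sz_sub => //; rewrite ltnS.
  have szs : (size (p1 - t0 *: p2)%R <= n.+1)%N.
    apply: leq_trans (size_polyD _ _) _; rewrite size_polyN geq_max -szp2 le12.
    exact: size_scale_leq.
  have srE : r1 - t0 *: r2 = (p1 - t0 *: p2) \Po ('X + c%:P).
    by rewrite comp_polyB comp_polyZ.
  have {}many : many_proj_roots n (r1 - t0 *: r2).
    rewrite srE; apply: (many_proj_roots_map (@proj_shift_inj _ c) _ many) => z.
    exact: proj_root_shift.
  apply: (many_proj_roots_map (@proj_inv_inj K) _ many) => z.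
  by apply: proj_root_reversal; rewrite srE size_comp_poly2 ?size_XaddC.
- move=> q1 q2 q20 copq gtq irr; apply: (irreducible_shift (c := c)).
  rewrite -/r1 -/r2; apply: irreducible_reversal.
    by rewrite coef_curve r20 scale0r subr0 scaler_eq0 negb_or r10.
  (* The coefficient of degree [n] is a combination of q1 and q2 with a nonzero coefficient at q1;
     it does not vanish, as q1 and q2 are linearly independent. *)
  suff -> : (size (curve r1 r2 q1 q2)).-1 = n by rewrite curve_reversal.
  suff -> : size (curve r1 r2 q1 q2) = n.+1 by [].
  apply/eqP; rewrite eqn_leq; apply/andP; split.
    apply/leq_sizeP => j lej; rewrite coef_curve !nth_default ?scale0r ?subrr //.
      by rewrite sz2.
    by rewrite sz1 (leq_trans _ lej) // -szp2.
  rewrite ltnNge; apply/negP => /leq_sizeP/(_ n (leqnn _)); rewrite coef_curve.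
  move/eqP; rewrite subr_eq0 eq_sym => /eqP e.
  by have [lc0 _] := coprimep_lin_indep copq gtq e; rewrite lc0 eqxx in lc2.
Qed.

Theorem curve_irreducible_proj p1 p2 q1 q2 :
  p2 != 0 -> q2 != 0 -> coprimep p1 p2 -> coprimep q1 q2 ->
  (1 < maxn (size p1) (size p2))%N -> (1 < maxn (size q1) (size q2))%N ->
  (forall t0, many_proj_roots (maxn (size p1) (size p2)).-1 (p1 - t0 *: p2) \/
              many_proj_roots (maxn (size q1) (size q2)).-1 (q1 - t0 *: q2)) ->
  irreducible_elt (curve p1 p2 q1 q2).
Proof.
move=> p20 q20 copp copq gtp gtq many.
have [p1' [p2' [p20' copp' [ltp _] sepp irrp]]] := normalize_pole p20 copp gtp.
have [q1' [q2' [q20' copq' [ltq _] sepq irrq]]] := normalize_pole q20 copq gtq.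
apply: irrp => //; apply: irreducible_curve_swap; apply: irrq => //.
  by rewrite leq_max (leq_ltn_trans _ ltp) // size_poly_gt0.
apply: normalized_curve_irreducible => // t0.
by case: (many t0) => [/sepp|/sepq]; [left | right].
Qed.

End Normalization.

(** * Critical values *)

Section RationalFunctions.
Variable K : closedFieldType.
Implicit Types (F P Q : ratfun K).

Lemma ratfun_coprimep F : coprimep (rnum F) (rden F).
Proof.
apply: Pdiv.ClosedField.root_coprimep => x nx.
by have := no_common_root F x; rewrite nx /= rootE.
Qed.

Lemma ratfun_size_gt1 F : ~ constant_ratfun F ->
  (1 < maxn (size (rnum F)) (size (rden F)))%N.
Proof.
apply: contra_notT; rewrite -leqNgt geq_max => /andP[/size1_polyC nE /size1_polyC dE].
have d0 : (rden F)`_0 != 0.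
  by apply: contraNneq (rden_neq0 F) => d0; rewrite dE d0.
exists ((rnum F)`_0 / (rden F)`_0); rewrite /ratfun_frac.
have dF0 : tofrac (rden F) != 0 by rewrite tofrac_eq0 rden_neq0.
apply: (mulIf dF0); rewrite divfK // -tofracM; congr (tofrac _).
by rewrite {1}nE {2}dE -polyCM divfK.
Qed.

Lemma degE F : deg F = (maxn (size (rnum F)) (size (rden F))).-1.
Proof. by rewrite /deg; move: (size _) (size _) => a b; lia. Qed.

Lemma CP1_of_coords_eq (a b u v : K) : (a, b) != 0 -> (u, v) != 0 ->
  (CP1_of_coords u v == CP1_of_coords a b) = (b * u - a * v == 0).
Proof.
rewrite -![(_, _) == 0]/((_ == 0) && (_ == 0)) !negb_and /CP1_of_coords.
case: (eqVneq b 0) => [->|b0]; case: (eqVneq v 0) => [->|v0] //=.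
- by rewrite mul0r mulr0 subr0 !eqxx.
- by rewrite orbF => a0 _; rewrite mul0r sub0r oppr_eq0 mulf_eq0 (negPf a0) (negPf v0).
- by rewrite orbF => _ u0; rewrite mulr0 subr0 mulf_eq0 (negPf b0) (negPf u0).
- move=> _ _; rewrite (inj_eq (@Some_inj _)) eqr_div // subr_eq0 mulrC.
  by [].
Qed.

(** Equality of points in homogeneous coordinates is the vanishing of a determinant. At infinity the
    coordinates are the coefficients of degree [deg F], one of which is nonzero. *)
Lemma fiberE F (a b : K) (z : CP1 K) : (1 < maxn (size (rnum F)) (size (rden F)))%N ->
  (a, b) != 0 ->
  fiber F (CP1_of_coords a b) z <->
  proj_root (deg F) (b *: rnum F - a *: rden F) z.
Proof.
move=> gt1 ab0; rewrite /fiber /preimage /=.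
have eqP' (u v : K) : (u, v) != 0 ->
    CP1_of_coords u v = CP1_of_coords a b <-> b * u - a * v == 0.
  by move=> uv0; rewrite -CP1_of_coords_eq //; split=> /eqP.
case: z => [x|] /=.
  rewrite rootE !hornerE; apply: eqP'; rewrite -[(_, _) == 0]/((_ == 0) && (_ == 0)).
  by have := no_common_root F x; rewrite !rootE.
rewrite coefB !coefZ; apply: eqP'; rewrite -[(_, _) == 0]/((_ == 0) && (_ == 0)).
rewrite degE; case: (leqP (size (rnum F)) (size (rden F))) gt1 => [le|lt] gt1.
  by rewrite negb_and -[(rden F)`_ _]lead_coefE lead_coef_eq0 rden_neq0 orbT.
rewrite negb_and -lead_coefE lead_coef_eq0 -size_poly_gt0.
by rewrite (ltn_trans _ gt1).
Qed.

Lemma not_critical_value F (a b : K) :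
  (1 < maxn (size (rnum F)) (size (rden F)))%N -> (a, b) != 0 ->
  ~ critical_values F (CP1_of_coords a b) ->
  many_proj_roots (deg F) (b *: rnum F - a *: rden F).
Proof.
move=> gt1 ab0; apply: contra_notP => few; set p := b *: rnum F - a *: rden F in few *.
have p0 : p != 0.
  apply: contraNneq ab0 => /eqP; rewrite subr_eq0 => /eqP e.
  by have [-> ->] := coprimep_lin_indep (ratfun_coprimep F) gt1 e.
have [r pr] := closed_field_poly_normal p.
(* The fibre listed without repetition; if it had at least [deg F] points, it would itself be the
   required list of roots. *)
pose s := [seq z <- undup (None :: map Some r) | proj_root (deg F) p z].
have sfib : fiber F (CP1_of_coords a b) = [set` s].
  apply/seteqP; split=> z /=.
    move/(fiberE z gt1 ab0); rewrite -/p => pz; rewrite mem_filter pz mem_undup.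
    case: z pz => [x|] //= px; rewrite inE mem_map; last by move=> ? ? [].
    by move: px; rewrite pr rootZ ?lead_coef_eq0 // root_prod_XsubC.
  by rewrite mem_filter => /andP[pz _]; apply/(fiberE z gt1 ab0).
have us : uniq s by rewrite filter_uniq // undup_uniq.
exists (size s).
  rewrite ltnNge; apply/negP => les; apply: few; exists s; split=> //.
  exact: filter_all.
rewrite sfib; apply/card_set_bijP; exists (index^~ s); split.
- by move=> z /= zs; rewrite index_mem.
- move=> x y; rewrite !inE => xs ys.
  by move/(congr1 (nth None s)); rewrite !nth_index.
- by move=> i /= lti; exists (nth None s i); rewrite /= ?mem_nth // index_uniq.
Qed.

Hypothesis charK : [pchar K] =i pred0.

(** A finite common critical value c is sent to infinity by F -> 1/(F - c), applied to both
    functions; this changes the curve only by a sign. No finite value is then critical for both. *)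
Theorem irreducible_critical_values P Q :
  ~ constant_ratfun P -> ~ constant_ratfun Q ->
  is_subset1 (critical_values P `&` critical_values Q) ->
  irreducible_elt (hPQ P Q).
Proof.
move=> /ratfun_size_gt1 gtP /ratfun_size_gt1 gtQ sub1.
have [s sP] : exists s, forall s', s' <> s ->
    ~ critical_values P s' \/ ~ critical_values Q s'.
  have [[s cs]|nos] := pselect (exists s, (critical_values P `&` critical_values Q) s).
    exists s => s' s's; apply/not_andP => cs'; apply: s's; exact: sub1.
  (* Without a common critical value any exceptional point will do; infinity makes the Moebius map
     unnecessary. *)
  by exists None => s' _; apply/not_andP => cs'; apply: nos; exists s'.
have many (a b : K) : (a, b) != 0 -> CP1_of_coords a b <> s ->
    many_proj_roots (maxn (size (rnum P)) (size (rden P))).-1 (b *: rnum P - a *: rden P) \/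
    many_proj_roots (maxn (size (rnum Q)) (size (rden Q))).-1 (b *: rnum Q - a *: rden Q).
  move=> ab0 /sP[]/not_critical_value h; [left|right]; rewrite -degE; exact: h.
case: s {sP} many => [c|] many; last first.
  apply: curve_irreducible_proj; rewrite ?rden_neq0 ?ratfun_coprimep // => t0.
  have := many t0 1; rewrite !scale1r; apply.
    by rewrite -[(_, _) == 0]/((_ == 0) && (_ == 0)) oner_eq0 andbF.
  by rewrite /CP1_of_coords oner_eq0.
have szE F : maxn (size (rden F)) (size (rnum F - c *: rden F)%R) =
    maxn (size (rnum F)) (size (rden F)).
  have le (p q : {poly K}) d : (size (p - d *: q)%R <= maxn (size p) (size q))%N.
    apply: leq_trans (size_polyD _ _) _; rewrite size_polyN geq_max leq_maxl /=.
    by rewrite (leq_trans (size_scale_leq _ _)) // leq_maxr.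
  have := le (rnum F) (rden F) c.
  have := le (rnum F - c *: rden F) (rden F) (- c); rewrite scaleNr opprK subrK.
  move: (size (rnum F)) (size (rden F)) (size (rnum F - c *: rden F)%R) => i j k.
  by lia.
have subF0 F : (1 < maxn (size (rnum F)) (size (rden F)))%N ->
    rnum F - c *: rden F != 0.
  move=> gt1; rewrite subr_eq0; apply/eqP => e.
  have [/eqP] : (1 : K) = 0 /\ c = 0.
    by apply: coprimep_lin_indep gt1 _; rewrite ?ratfun_coprimep ?scale1r.
  by rewrite oner_eq0.
have cop F : coprimep (rden F) (rnum F - c *: rden F).
  apply: Pdiv.ClosedField.root_coprimep => x dx; rewrite !hornerE (rootP dx) mulr0 subr0.
  by have := ratfun_coprimep F; rewrite coprimep_sym => /coprimep_root; apply.
apply: irreducible_opp.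
have -> : - hPQ P Q = curve (rden P) (rnum P - c *: rden P) (rden Q) (rnum Q - c *: rden Q).
  apply/polyP => i; rewrite coefN -[hPQ P Q]/(curve _ _ _ _) !coef_curve.
  by rewrite coefB coefZ -!mul_polyC !polyCB !polyCM; ring.
apply: curve_irreducible_proj; rewrite ?subF0 ?szE // => t0.
(* The equation 1/(F - c) = t0 reads F = [1 + c t0 : t0], which is never the point c. *)
have := many (1 + c * t0) t0.
have e F : t0 *: rnum F - (1 + c * t0) *: rden F = - (rden F - t0 *: (rnum F - c *: rden F)).
  by rewrite -!mul_polyC polyCD polyCM; ring.
have neg n (p : {poly K}) : many_proj_roots n (- p) -> many_proj_roots n p.
  apply: (many_proj_roots_map (h := id)) => // -[x|] /=; first by rewrite rootN.
  by rewrite coefN oppr_eq0.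
rewrite !e => h; case: h => [||/neg|/neg]; [| |by left|by right].
  rewrite -[(_, _) == 0]/((_ == 0) && (_ == 0)) negb_and orbC.
  by case: (eqVneq t0 0) => [->|//]; rewrite mulr0 addr0 oner_eq0.
rewrite /CP1_of_coords; case: eqVneq => // t00 [].
rewrite mulrDl mul1r mulfK // => /(canRL (addrK _)).
rewrite subrr => /eqP; rewrite invr_eq0; exact/negP.
Qed.

End RationalFunctions.

(** * Coprime degrees *)

Section CoprimeDegrees.
Variable K : closedFieldType.
Hypothesis charK : [pchar K] =i pred0.
Implicit Types (p q d : {poly K}) (A B : {poly {poly K}}).

Lemma count_roots_dvdp d (s : seq K) : uniq s ->
  d %| \prod_(x <- s) ('X - x%:P) -> count (root d) s = (size d).-1.
Proof.
move=> us /dvdp_prod_XsubC [m dE].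
rewrite (eqp_size dE) size_prod_XsubC /= (mask_filter m us) size_filter.
by apply: eq_count => x; rewrite (eqp_root dE) root_prod_XsubC.
Qed.

Lemma map_curve_eval p1 p2 q1 q2 y :
  map_poly (horner_eval y) (curve p1 p2 q1 q2) = q2.[y] *: p1 - q1.[y] *: p2.
Proof.
apply/polyP => i; rewrite coef_map coef_curve coefB !coefZ /= /horner_eval.
by rewrite !hornerE mulrC [q1.[y] * _]mulrC.
Qed.

Lemma separable_rootsP p : separable_poly p ->
  exists s : seq K, [/\ uniq s, p %= \prod_(x <- s) ('X - x%:P) &
    size s = (size p).-1].
Proof.
move=> sep; have [s ps] := closed_field_poly_normal p.
have p0 : p != 0.
  apply: contraTneq sep => ->.
  by rewrite separable_poly.unlock deriv0 /coprimep gcdpp size_poly0.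
have lc0 : lead_coef p != 0 by rewrite lead_coef_eq0.
have pE : p %= \prod_(x <- s) ('X - x%:P) by rewrite {1}ps eqp_scale.
exists s; split=> //; last by rewrite (eqp_size pE) size_prod_XsubC.
by rewrite -separable_prod_XsubC -(eqp_separable pE).
Qed.

(* On the n x m grid of points of two generic fibres over the same value, the
   zeros of a factor of bidegree (a, b) fill a cells of each of the m lines
   parallel to the first axis and b cells of each of the n others. *)
Lemma factor_bidegree p1 p2 q1 q2 A B :
  p2 != 0 -> q2 != 0 -> coprimep p1 p2 -> coprimep q1 q2 ->
  (size p2 < size p1)%N -> (size q2 < size q1)%N -> curve p1 p2 q1 q2 = A * B ->
  ((size q1).-1 * (size A).-1 = (size p1).-1 * (size (swapXY A)).-1)%N.
Proof.
move=> p20 q20 copp copq ltp ltq cE.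
have [sp sepp] := separable_pencil (wronskian_neq0 charK p20 ltp) copp.
have [sq sepq] := separable_pencil (wronskian_neq0 charK q20 ltq) copq.
have [t0] := closed_avoid (sp ++ sq).
rewrite mem_cat negb_or => /andP[/sepp {}sepp /sepq {}sepq].
have szs (r1 r2 : {poly K}) : (size r2 < size r1)%N -> size (r1 - t0 *: r2) = size r1.
  move=> lt; rewrite size_polyDl // size_polyN.
  exact: leq_ltn_trans (size_scale_leq _ _) lt.
have [xs [uxs pE szx]] := separable_rootsP sepp.
have [ys [uys qE szy]] := separable_rootsP sepq.
rewrite szs // in szx; rewrite szs // in szy.
(* On the line at height y in [vs] the curve restricts to s2(y) (r1 - t0 r2), whose roots are the
   distinct points of [us]; the restricted factor divides it. *)
have half (r1 r2 s1 s2 : {poly K}) (us vs : seq K) (G H : {poly {poly K}}) :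
    s2 != 0 -> coprimep s1 s2 -> (size r2 < size r1)%N -> uniq us ->
    r1 - t0 *: r2 %= \prod_(x <- us) ('X - x%:P) ->
    s1 - t0 *: s2 %= \prod_(y <- vs) ('X - y%:P) ->
    curve r1 r2 s1 s2 = G * H ->
    \sum_(y <- vs) count (fun x => G.[x, y] == 0) us = (size vs * (size G).-1)%N.
  move=> s20 cop lt uus rE sE GH.
  rewrite -sum1_size big_distrl /=; rewrite !big_seq; apply: eq_bigr => y yv.
  have s1y : s1.[y] = t0 * s2.[y].
    apply/eqP; rewrite -subr_eq0 -hornerZ -hornerN -hornerD.
    by rewrite -[_ == 0]/(root _ y) (eqp_root sE) root_prod_XsubC.
  have s2y : s2.[y] != 0.
    apply/negP => s2y; have rs1 : root s1 y by rewrite rootE s1y (eqP s2y) mulr0.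
    by have := coprimep_root cop rs1; rewrite s2y.
  (* The degree of [G] does not drop on the line, since its leading coefficient divides a constant
     multiple of s2 and s2(y) is nonzero. *)
  have Gy0 : horner_eval y (lead_coef G) != 0.
    have := lead_coef_curve s20 s1 lt; rewrite GH lead_coefM => /(congr1 (horner^~ y)).
    rewrite hornerM hornerZ /horner_eval => e; apply: contraNneq s2y => Gy.
    move: e; rewrite Gy mul0r => /esym/eqP; rewrite mulf_eq0 => /orP[|//].
    by rewrite lead_coef_eq0 -size_poly_eq0 -leqn0 leqNgt (leq_ltn_trans _ lt).
  have -> : size G = size (map_poly (horner_eval y) G) by rewrite size_map_poly_id0.
  rewrite mul1n -(count_roots_dvdp uus).
    by apply: eq_count => x; rewrite rootE -horner_swapXY horner2_swapXY.
  rewrite -(eqp_dvdr _ rE) -(dvdpZr _ _ s2y) scalerBr scalerA [_ * t0]mulrC -s1y.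
  by rewrite -map_curve_eval GH rmorphM dvdp_mulr.
have h1 := half _ _ _ _ _ _ _ _ q20 copq ltp uxs pE qE cE.
have h2 : \sum_(x <- xs) count (fun y => A.[x, y] == 0) ys =
    (size xs * (size (swapXY A)).-1)%N.
  have cE' : curve q1 q2 p1 p2 = swapXY A * - swapXY B.
    rewrite mulrN -rmorphM /= -cE /curve rmorphB !rmorphM /= !swapXY_polyC.
    by rewrite !swapXY_map_polyC opprB [q1^:P * _]mulrC [q2^:P * _]mulrC.
  rewrite -(half _ _ _ _ _ _ _ _ p20 copp ltq uys qE pE cE').
  by apply: eq_bigr => x _; apply: eq_count => y; rewrite horner2_swapXY.
rewrite -szx -szy -h1 -h2.
(* Double counting of the zeros of [A] on the grid, by rows and by columns. *)
under eq_bigr do rewrite -sum1_count big_mkcond.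
rewrite exchange_big; apply: eq_bigr => x _ /=.
by rewrite -big_mkcond sum1_count.
Qed.

Theorem irreducible_coprime_degrees p1 p2 q1 q2 :
  p2 != 0 -> q2 != 0 -> coprimep p1 p2 -> coprimep q1 q2 ->
  (1 < maxn (size p1) (size p2))%N -> (1 < maxn (size q1) (size q2))%N ->
  coprime (maxn (size p1) (size p2)).-1 (maxn (size q1) (size q2)).-1 ->
  irreducible_elt (curve p1 p2 q1 q2).
Proof.
move=> p20 q20 copp copq gtp gtq.
have [p1' [p2' [p20' copp' [ltp <-] _ irrp]]] := normalize_pole p20 copp gtp.
have [q1' [q2' [q20' copq' [ltq <-] _ irrq]]] := normalize_pole q20 copq gtq.
move=> copd; apply: irrp => //; apply: irreducible_curve_swap; apply: irrq => //.
  by rewrite leq_max (leq_ltn_trans _ ltp) // size_poly_gt0.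
apply: irreducible_curve => // [|A B cE].
  by rewrite (leq_ltn_trans _ ltq) // size_poly_gt0.
have bideg := factor_bidegree q20' p20' copq' copp' ltq ltp cE.
have szc := size_curve p20' p1' ltq.
have [A0 B0] : A != 0 /\ B != 0.
  apply/andP; rewrite -negb_or -mulf_eq0 -cE -size_poly_eq0 szc.
  by rewrite -lt0n (leq_ltn_trans _ ltq).
have := szc; rewrite cE size_mul // => szAB.
have [A1 B1] : (0 < size A)%N /\ (0 < size B)%N by rewrite !size_poly_gt0.
(* The degree of the curve in the outer variable divides that of [A], so one of the two factors
   takes all of it. *)
have : ((size q1').-1 %| (size A).-1)%N.
  by rewrite -(Gauss_dvdr _ (_ : coprime _ (size p1').-1)) 1?coprime_sym // bideg dvdn_mulr.
case: (posnP (size A).-1) => [A2 _|A2 /(dvdn_leq A2)].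
  by left; move: A1 A2; case: (size A) => [|[]].
move: szAB A1 B1 A2; move: (size A) (size B) (size q1') => a b c; lia.
Qed.

End CoprimeDegrees.

(** * Simple poles *)

Section SimplePoles.
Variable K : closedFieldType.
Hypothesis charK : [pchar K] =i pred0.
Implicit Types (P Q : ratfun K).

Lemma is_polynomial_den P : is_polynomial P -> size (rden P) = 1%N.
Proof.
case=> p pE; have dF0 : tofrac (rden P) != 0 by rewrite tofrac_eq0 rden_neq0.
have /eqP : tofrac (rnum P) = tofrac (p * rden P).
  by rewrite tofracM -pE /ratfun_frac divfK.
rewrite tofrac_eq => /eqP nE.
have dn : rden P %| rnum P by rewrite nE dvdp_mull.
by rewrite -(eqp_size (dvdp_gcd_idr dn)); apply/eqP; exact: ratfun_coprimep.
Qed.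

(* Eisenstein's argument with respect to the outer variable: at a simple pole
   [y0] of [Q] the leading coefficient has a simple zero and all the others but
   the constant one vanish. *)
Lemma irreducible_simple_pole P Q (y0 : K) :
  ~ constant_ratfun P -> size (rden P) = 1%N -> root (rden Q) y0 ->
  mup y0 (rden Q) = 1%N -> irreducible_elt (hPQ P Q).
Proof.
move=> /ratfun_size_gt1 gt1 dP dQ simple.
have q20 := rden_neq0 Q.
have lt : (size (rden P) < size (rnum P))%N.
  by move: gt1; rewrite dP; case: (size _) => [|[]].
apply: irreducible_curve; rewrite ?ratfun_coprimep //; first by rewrite -dP.
move=> A B cE.
have lE : lead_coef A * lead_coef B = lead_coef (rnum P) *: rden Q.
  by rewrite -lead_coefM -cE lead_coef_curve.
have p10 : lead_coef (rnum P) != 0.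
  by rewrite lead_coef_eq0 -size_poly_gt0 (leq_ltn_trans _ lt).
have q1y : (rnum Q).[y0] != 0.
  by have := ratfun_coprimep Q; rewrite coprimep_sym => /coprimep_root; apply.
pose ev := map_poly (horner_eval y0).
(* At y0 the curve becomes a nonzero constant, so both factors specialize to constants. A factor of
   positive degree thus loses its leading coefficient at y0; two such factors would give [rden Q] a
   double root. *)
have AB : ev A * ev B = - (rnum Q).[y0] *: rden P.
  by rewrite -rmorphM -cE /= map_curve_eval (rootP dQ) scale0r sub0r scaleNr.
have szAB : size (ev A * ev B) = 1%N by rewrite AB size_scale ?oppr_eq0.
have [A0 B0] : ev A != 0 /\ ev B != 0.
  by apply/andP; rewrite -negb_or -mulf_eq0 -size_poly_eq0 szAB.
have szev : size (ev A) = 1%N /\ size (ev B) = 1%N.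
  move: szAB A0 B0; rewrite -!size_poly_gt0 => + A0 B0.
  rewrite size_mul -?size_poly_gt0 //; move: A0 B0.
  by move: (size (ev A)) (size (ev B)) => a b; lia.
have vanish (G : {poly {poly K}}) : size (ev G) = 1%N -> size G <> 1%N ->
    'X - y0%:P %| lead_coef G.
  move=> szG G1; rewrite dvdp_XsubCl; apply/rootP.
  have : (ev G)`_(size G).-1 = 0.
    rewrite nth_default // szG; have : (size (ev G) <= size G)%N by exact: size_poly.
    by rewrite szG; case: (size G) G1 => [|[|]].
  by rewrite coef_map.
have [A1|/eqP A1] := eqVneq (size A) 1%N; first by left.
have [B1|/eqP B1] := eqVneq (size B) 1%N; first by right.
have : ('X - y0%:P) ^+ 2 %| rden Q.
  rewrite -(dvdpZr _ _ p10) -lE expr2 dvdp_mul //.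
    by apply: vanish; [case: szev | ].
  by apply: vanish; [case: szev | ].
by rewrite -mup_geq // simple.
Qed.

(** A finite pole of Q is handled by [irreducible_simple_pole]. Otherwise Q is a polynomial whose
    only pole, infinity, is simple; then Q has degree 1 and the coprime case applies. *)
Theorem irreducible_no_multiple_poles P Q :
  ~ constant_ratfun P -> ~ constant_ratfun Q ->
  is_polynomial P -> no_multiple_poles Q -> irreducible_elt (hPQ P Q).
Proof.
move=> ncP ncQ /is_polynomial_den dP simple.
have [sz1|/closed_rootP [y0 dQ]] := boolP (size (rden Q) == 1%N); last first.
  apply: irreducible_simple_pole (dQ) _ => //.
  have val : ratfun_map Q (Some y0) = None.
    by rewrite /= /CP1_of_coords (eqP dQ : (rden Q).[y0] = 0) eqxx.
  by have := simple (Some y0) val; rewrite /local_mult val.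
have gtQ := ratfun_size_gt1 ncQ; have gtP := ratfun_size_gt1 ncP.
have ltQ : (1 < size (rnum Q))%N by move: gtQ; rewrite (eqP sz1); case: (size _) => [|[]].
have val : ratfun_map Q None = None.
  rewrite /= /CP1_of_coords [(rden Q)`_ _]nth_default ?eqxx //.
  rewrite degE (eqP sz1); move: ltQ; move: (size (rnum Q)) => a; lia.
(* With a constant denominator, the local multiplicity at infinity is the full degree. *)
have := simple None val; rewrite /local_mult val /= (eqP sz1) subn0 => deg1.
apply: irreducible_coprime_degrees; rewrite ?rden_neq0 ?ratfun_coprimep //.
by rewrite -[X in coprime _ X]degE deg1 coprimen1.
Qed.

End SimplePoles.

Theorem proposition3p1 (R : realType) (P Q : ratfun R[i]) (n m : nat)
    (hP : ~ constant_ratfun P) (hQ : ~ constant_ratfun Q)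
    (hn : deg P = n) (hm : deg Q = m) :
  [\/ is_subset1 (critical_values P `&` critical_values Q),
      gcdn n m = 1%N
    | is_polynomial P /\ no_multiple_poles Q] ->
  irreducible_elt (hPQ P Q).
Proof.
have charC : [pchar R[i]] =i pred0 by exact: Num.Theory.pchar_num.
case=> [sub1|gcd1|[polP simpleQ]].
- exact: irreducible_critical_values.
- apply: irreducible_coprime_degrees; rewrite ?rden_neq0 ?ratfun_coprimep //.
  + exact: ratfun_size_gt1.
  + exact: ratfun_size_gt1.
  + by rewrite -!degE hn hm /coprime gcd1.
- exact: irreducible_no_multiple_poles.
Qed.
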